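(* Let real Hilbert spaces $V\subset H$, operators $A$, $A_{\rm rc}$, $\mathcal N$ and a sequence of actuator sets $(U_M)_{M\in\mathbb N_0}$ satisfy (A1)–(A5) of the context. Let $\rho\le1$, $R>0$ and $\mu>0$ be given, and let $H=\mathcal U_M\oplus\widetilde{\mathcal U}_M^\perp$ (for each $M$), with auxiliary spaces $\widetilde{\mathcal U}_M\subset V$ as in the context. Then, if $M\in\mathbb N_0$ and $\lambda>0$ are large enough (that is: there is $M_*\in\mathbb N_0$ such that for every $M\ge M_*$ there is $\lambda_*=\lambda_*(M)>0$ such that the following holds for every $\lambda\ge\lambda_*$), the solutions of both systems $$\dot y+Ay+A_{\rm rc}(t)y+\mathcal N(t,y)=-\lambda P_{\mathcal U_M}y,\qquad y(0)=y_0,$$ and $$\dot y+Ay+A_{\rm rc}(t)y+\mathcal N(t,y)=-\lambda P_{\mathcal U_M}^{\widetilde{\mathcal U}_M^\perp}A^\rho P_{\widetilde{\mathcal U}_M}^{\mathcal U_M^\perp}y,\qquad y(0)=y_0,$$ satisfy $$|y(t)|_H\le\mathrm e^{-\mu(t-s)}|y(s)|_H\quad\text{for all }t\ge s\ge0\ \text{ and all }y_0\in H\text{ with }|y_0|_H<R.$$ In particular, $t\mapsto|y(t)|_H$ is strictly decreasing at time $t=s$ if $|y(s)|_H\ne0$. Furthermore, $M$ and $\lambda$ can be chosen as $M=\overline C_{[R,\mu,C_{\rm rc},C_{\mathcal N}]}$ and $\lambda=\overline C_{[R,\mu,C_{\rm rc},C_{\mathcal N}]}$.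
   Context: Notation: $\mathbb N_0=\{1,2,3,\dots\}$, $\mathbb R_0=(0,\infty)$. $\overline C_{[a_1,\dots,a_k]}$ denotes a nonnegative function that increases (is nondecreasing) in each of its nonnegative arguments; different occurrences may be different functions, and they may depend on the fixed data (the spaces, $A$, $\rho$, the sequences of actuator sets and auxiliary spaces, and the number $n$ and exponents in (A4)). $\mathcal L(X,Y)$ is the space of continuous linear maps. For Banach spaces $X,Y$ continuously included in a common space, $X+Y$ carries the norm $|z|_{X+Y}=\inf\{(|h|_X^2+|g|_Y^2)^{1/2}: z=h+g,\ h\in X,\ g\in Y\}$; here $\mathcal L(H,V')$ and $\mathcal L(V,H)$ are viewed inside $\mathcal L(V,V')$. $\mathcal C_{\mathrm b,\iota}(X,Y)$ is the set of continuous $f:X\to Y$ for which there is a continuous nondecreasing $\mathfrak i:[0,\infty)\to\mathbb R$ with $\mathfrak i(0)=0$ and $|f(x)|_Y\le\mathfrak i(|x|_X)$ for all $x\in X$. The symbol $\perp$ denotes orthogonality in $H$, $P_F$ is the orthogonal projection in $H$ onto $F$, and for closed subspaces with $H=F\oplus G$, $P_F^G$ is the oblique projection in $H$ onto $F$ along $G$ (if $h=h_F+h_G$ with $h_F\in F$, $h_G\in G$, then $P_F^Gh=h_F$). Setting: $V\subset H$ are real Hilbert spaces, $H$ is identified with its dual, $V\subset H\subset V'$. (A1) $A\in\mathcal L(V,V')$ is symmetric and $(y,z)\mapsto\langle Ay,z\rangle_{V',V}$ is a complete scalar product on $V$; $V$ is endowed with this scalar product and the associated norm. (A2) The inclusion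 $V\subseteq H$ is dense, continuous, and compact. (A3) For almost every $t>0$, $A_{\rm rc}(t)\in\mathcal L(H,V')+\mathcal L(V,H)$, and $C_{\rm rc}:=|A_{\rm rc}|_{L^\infty(\mathbb R_0,\mathcal L(H,V')+\mathcal L(V,H))}<+\infty$. (A4) For almost every $t>0$, $\mathcal N(t,\cdot)\in\mathcal C_{\mathrm b,\iota}(V,V')$, and there are constants $C_{\mathcal N}\ge0$, $n\in\mathbb N_0$, $\zeta_{1j},\zeta_{2j},\delta_{1j},\delta_{2j}\ge0$ ($1\le j\le n$), with $\zeta_{2j}+\delta_{2j}<1$ and $\delta_{1j}+\delta_{2j}\ge1$, such that for all $t>0$ and all $(y_1,y_2)\in V\times V$ $$|\mathcal N(t,y_1)-\mathcal N(t,y_2)|_{V'}\le C_{\mathcal N}\sum_{j=1}^n\left(|y_1|_H^{\zeta_{1j}}|y_1|_V^{\zeta_{2j}}+|y_2|_H^{\zeta_{1j}}|y_2|_V^{\zeta_{2j}}\right)|y_1-y_2|_H^{\delta_{1j}}|y_1-y_2|_V^{\delta_{2j}}.$$ Further, $\mathcal N(\cdot,y)\in L^1_{\rm loc}(\mathbb R_0,V')$ for every $y\in V$. (A5) For each $M\in\mathbb N_0$, $U_M=\{\Phi_j\mid 1\le j\le M_\sigma\}\subset H$, where $M_\sigma=\sigma(M)$ with $\sigma:\mathbb N_0\to\mathbb N_0$ strictly increasing, $\mathcal U_M=\operatorname{span}U_M$, $\dim\mathcal U_M=M_\sigma$. With $\xi_{M_+}:=\inf_{\Theta\in(V\cap\mathcal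 U_M^\perp)\setminus\{0\}}\frac{|\Theta|_V^2}{|\Theta|_H^2}$ we have $\lim_{M\to+\infty}\xi_{M_+}=+\infty$. Auxiliary spaces: for each $M$, $\widetilde{\mathcal U}_M\subset V$ is a subspace with $\dim\widetilde{\mathcal U}_M=M_\sigma$. Fractional powers: $A$ has a nondecreasing sequence of eigenvalues $0<\alpha_1\le\alpha_2\le\cdots\to+\infty$ with a corresponding complete orthonormal basis of eigenfunctions $e_n$ of $H$, $Ae_n=\alpha_ne_n$; for $\zeta\in\mathbb R$, $A^\zeta\sum y_ne_n:=\sum\alpha_n^\zeta y_ne_n$. For $y\in H$ and $\rho\le 1$ one has $P_{\widetilde{\mathcal U}_M}^{\mathcal U_M^\perp}y\in V$ and $A^\rho P_{\widetilde{\mathcal U}_M}^{\mathcal U_M^\perp}y\in V'$; in the second system $P_{\mathcal U_M}^{\widetilde{\mathcal U}_M^\perp}$ denotes the extension to $V'$ of the oblique projection in $H$, defined for $f\in V'$ by $P_{\mathcal U_M}^{\widetilde{\mathcal U}_M^\perp}f\in\mathcal U_M$ and $\langle P_{\mathcal U_M}^{\widetilde{\mathcal U}_M^\perp}f,\phi\rangle_{V',V}=\langle f,P_{\widetilde{\mathcal U}_M}^{\mathcal U_M^\perp}\phi\rangle_{V',V}$ for all $\phi\in V$. ''The solution'' means the weak solution defined for all $t>0$: $y\in L^2((0,T),V)$ with $\dot y\in L^2((0,T),V')$ for every $T>0$ (hence $y\in C([0,\infty),H)$), the equation holding in $V'$ for almost every $t>0$. ''Strictly decreasing at time $s$'' means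 in particular $|y(t)|_H<|y(s)|_H$ for $t>s$. *)

(* Defs.v *)
From HB Require Import structures.
From mathcomp Require Export all_boot all_order all_algebra.
From mathcomp Require Export all_classical all_reals all_analysis.
From mathcomp Require Export ess_sup_inf sesquilinear.

Set Implicit Arguments.
Unset Strict Implicit.
Unset Printing Implicit Defensive.

Import Order.TTheory GRing.Theory Num.Theory.
Import numFieldNormedType.Exports.

Local Open Scope classical_set_scope.
Local Open Scope ring_scope.

(* Elements of V' are represented by plain functions f : V -> R^o; f belongs
   to V' iff [dnorm f < +oo].  All norms of spaces of linear maps below are
   extended-valued and equal to +oo outside of the space. *)

Section OperatorNorms.
Context (R : realType).

(* inf of all c >= 0 with nY (B x) <= c |x|, and +oo if B is not linear and
   bounded; hence B \in L(X, Y) iff [opnorm nY B < +oo]. *)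
Definition opnorm (X : normedModType R) (Y : lmodType R) (nY : Y -> \bar R)
    (B : X -> Y) : \bar R :=
  ereal_inf [set c%:E | c in [set c : R |
    [/\ 0 <= c, linear B & forall x, (nY (B x) <= (c * `|x|)%:E)%E]]].

Definition enorm (X : normedModType R) (x : X) : \bar R := `|x|%:E.

Definition dnorm (V : normedModType R) (f : V -> R^o) : \bar R :=
  opnorm (@enorm R^o) f.

End OperatorNorms.

Section Bochner.
Context (R : realType).
Local Notation mu := (@lebesgue_measure R).

(* [nX] is the norm of a space of elements of [X] (the x with nX x < +oo). *)
Definition strongly_measurable (X : zmodType) (nX : X -> \bar R) (D : set R)
    (f : R -> X) : Prop :=
  exists s : nat -> R -> X,
    [/\ forall k, finite_set (range (s k)),
        forall k x, measurable (s k @^-1` [set x]),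
        forall k t, (nX (s k t) < +oo)%E
      & {ae mu, forall t, D t -> nX (f t - s k t) @[k --> \oo] --> 0%E}].

Definition Lp (X : zmodType) (p : nat) (nX : X -> \bar R) (D : set R)
    (f : R -> X) : Prop :=
  strongly_measurable nX D f /\ (\int[mu]_(t in D) (nX (f t) ^+ p) < +oo)%E.

Definition Linfty_norm (X : zmodType) (nX : X -> \bar R) (D : set R)
    (f : R -> X) : \bar R :=
  ess_sup mu ((fun t => nX (f t)) \_ D).

(* C^1 functions with compact support in (0, +oo) *)
Definition test_function (phi : R -> R^o) : Prop :=
  [/\ forall t : R, derivable phi t 1, continuous (derive1 phi) &
      exists a b : R, 0 < a /\ forall t, t \notin `[a, b] -> phi t = 0].

End Bochner.

Section Subspaces.
Context (R : realType).

Definition lin_indep (E : lmodType R) (n : nat) (b : 'I_n -> E) : Prop :=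
  forall c : 'I_n -> R, \sum_(i < n) c i *: b i = 0 -> forall i, c i = 0.

Definition lspan (E : lmodType R) (n : nat) (b : 'I_n -> E) : set E :=
  [set x | exists c : 'I_n -> R, x = \sum_(i < n) c i *: b i].

Definition has_dim (E : lmodType R) (W : set E) (n : nat) : Prop :=
  exists b : 'I_n -> E, lin_indep b /\ W = lspan b.

(* H = F (+) G, for linear subspaces F and G *)
Definition direct_sum (E : lmodType R) (F G : set E) : Prop :=
  (forall h, exists f g, [/\ F f, G g & h = f + g]) /\ F `&` G = [set 0].

(* P_F^G *)
Definition oblique_proj (E : lmodType R) (F G : set E) (h : E) : E :=
  xget 0 [set f | F f /\ G (h - f)].

Definition perp (H : lmodType R) (dot : {dot H for idfun}) (F : set H) :
  set H := [set h | forall f, F f -> dot h f = 0].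

(* P_F *)
Definition orth_proj (H : lmodType R) (dot : {dot H for idfun}) (F : set H) :
  H -> H := oblique_proj F (perp dot F).

End Subspaces.

Section Setting.
Context (R : realType) (H V : completeNormedModType R).
(* inner product of H, and the inclusion V -> H *)
Context (dot : {dot H for idfun}) (iota : {linear V -> H}).
Local Notation mu := (@lebesgue_measure R).
Local Notation Rpos := (`]0, +oo[%classic : set R).

(* the inclusion H -> V' *)
Definition toV' (h : H) : V -> R^o := fun v => dot h (iota v).

(* The last condition says that V carries the norm of the scalar product
   <A y, z>; its completeness is that of the type V. *)
Definition assumption_A1 (A : V -> V -> R^o) : Prop :=
  [/\ (opnorm (@dnorm R V) A < +oo)%E,
      forall y z, A y z = A z y &
      forall y, A y y = `|y| ^+ 2].

Definition assumption_A2 : Prop :=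
  [/\ injective iota, continuous iota, dense (range iota) &
      forall B : set V, bounded_set B -> precompact (iota @` B)].

(* norm of L(H, V') + L(V, H), as a subspace of L(V, V') *)
Definition sum_norm (B : V -> V -> R^o) : \bar R :=
  ereal_inf [set x | exists (B1 : H -> V -> R^o) (B2 : V -> H),
    [/\ (opnorm (@dnorm R V) B1 < +oo)%E, (opnorm (@enorm R H) B2 < +oo)%E,
        forall v w, B v w = B1 (iota v) w + toV' (B2 v) w &
        x = (Num.sqrt (fine (opnorm (@dnorm R V) B1) ^+ 2
                       + fine (opnorm (@enorm R H) B2) ^+ 2))%:E]].

Definition assumption_A3 (Arc : R -> V -> V -> R^o) (Crc : R) : Prop :=
  [/\ {ae mu, forall t, 0 < t -> (sum_norm (Arc t) < +oo)%E},
      strongly_measurable sum_norm Rpos Arc &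
      Linfty_norm sum_norm Rpos Arc = Crc%:E].

(* C_{b,iota}(V, V') *)
Definition Cb_iota (f : V -> V -> R^o) : Prop :=
  [/\ forall x, (dnorm (f x) < +oo)%E,
      forall x, dnorm (f z - f x) @[z --> x] --> 0%E &
      exists i : R -> R,
        [/\ {within `[0, +oo[, continuous i},
            {in `[0, +oo[ &, {homo i : r s / r <= s}},
            i 0 = 0 & forall x, (dnorm (f x) <= (i `|x|)%:E)%E]].

(* Note that 0 `^ 0 = 1: a factor with zero exponent is absent. *)
Definition assumption_A4 (n : nat) (zeta1 zeta2 delta1 delta2 : 'I_n -> R)
    (N : R -> V -> V -> R^o) (CN : R) : Prop :=
  [/\ {ae mu, forall t, 0 < t -> Cb_iota (N t)},
      0 <= CN,
      forall t : R, 0 < t -> forall y1 y2 : V,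
        (dnorm (N t y1 - N t y2)%R
         <= (CN * \sum_(j < n)
               (`|iota y1| `^ zeta1 j * `|y1| `^ zeta2 j
                + `|iota y2| `^ zeta1 j * `|y2| `^ zeta2 j)
               * `|iota (y1 - y2)| `^ delta1 j * `|y1 - y2| `^ delta2 j)%:E)%E &
      forall y (a b : R), 0 < a -> Lp 1 (@dnorm R V) `[a, b] (fun t => N t y)].

Definition A4_exponents (n : nat) (zeta1 zeta2 delta1 delta2 : 'I_n -> R) :
    Prop :=
  (0 < n)%N /\ forall j,
    [/\ [/\ 0 <= zeta1 j, 0 <= zeta2 j, 0 <= delta1 j & 0 <= delta2 j],
        zeta2 j + delta2 j < 1 & 1 <= delta1 j + delta2 j].

(* xi_{M_+}, for U = U_M *)
Definition xi_plus (U : set H) : \bar R :=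
  ereal_inf [set (`|v| ^+ 2 / `|iota v| ^+ 2)%:E | v in
    [set v : V | perp dot U (iota v) /\ v != 0]].

(* The index M = 0 is not used. *)
Definition assumption_A5 (sigma : nat -> nat)
    (Phi : forall M : nat, 'I_(sigma M) -> H) : Prop :=
  [/\ forall M, (0 < M)%N -> (0 < sigma M)%N,
      forall M M', (0 < M)%N -> (M < M')%N -> (sigma M < sigma M')%N,
      forall M, (0 < M)%N -> has_dim (lspan (Phi M)) (sigma M) &
      xi_plus (lspan (Phi M)) @[M --> \oo] --> +oo%E].

(* (alpha_n, e_n) is a complete orthonormal system of eigenpairs of A,
   enumerated from n = 0 *)
Definition eigenbasis (A : V -> V -> R^o) (alpha : nat -> R) (e : nat -> V) :
    Prop :=
  [/\ (forall n, 0 < alpha n) /\ {homo alpha : m n / (m <= n)%N >-> m <= n},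
      alpha @ \oo --> +oo,
      forall n, A (e n) = alpha n *: toV' (iota (e n)),
      forall m n, dot (iota (e m)) (iota (e n)) = (m == n)%:R &
      forall h : H,
        (\sum_(0 <= k < n) dot h (iota (e k)) *: iota (e k)) @[n --> \oo] --> h].

(* A^rho w as an element of V': the sum of the series
   \sum_k alpha_k^rho (w, e_k)_H e_k, which converges in V' for rho <= 1. *)
Definition frac_power (alpha : nat -> R) (e : nat -> V) (rho : R) (w : V) :
    V -> R^o :=
  xget 0 [set f : V -> R^o |
    dnorm (f - \sum_(0 <= k < n)
             (alpha k `^ rho * dot (iota w) (iota (e k))) *: toV' (iota (e k)))
      @[n --> \oo] --> 0%E].

(* P_{Ut}^{U^perp} : H -> V, for a subspace Ut of V *)
Definition aux_proj (U : set H) (Ut : set V) (h : H) : V :=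
  xget 0 [set w | Ut w /\
    iota w = oblique_proj (iota @` Ut) (perp dot U) h].

(* extension to V' of P_U^{Ut^perp} *)
Definition ext_proj (U : set H) (Ut : set V) (f : V -> R^o) : H :=
  xget 0 [set u | U u /\
    forall phi : V, toV' u phi = f (aux_proj U Ut (iota phi))].

Definition feedback_orth (U : set H) : H -> V -> R^o :=
  fun h => toV' (orth_proj dot U h).

Definition feedback_oblique (alpha : nat -> R) (e : nat -> V) (rho : R)
    (U : set H) (Ut : set V) : H -> V -> R^o :=
  fun h => toV' (ext_proj U Ut (frac_power alpha e rho (aux_proj U Ut h))).

(* dy is the distributional derivative on (0, +oo) of y, as a V'-valued
   function; the V'-valued integrals are evaluated at each v in V. *)
Definition weak_derivative (y : R -> H) (dy : R -> V -> R^o) : Prop :=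
  forall (phi : R -> R^o) (v : V), test_function phi ->
    \int[mu]_(t in Rpos) (derive1 phi t * toV' (y t) v)
    = - \int[mu]_(t in Rpos) (phi t * dy t v).

(* y is the continuous H-valued representative, and yV its V-valued one. *)
Definition weak_solution (A : V -> V -> R^o) (Arc N : R -> V -> V -> R^o)
    (lambda : R) (F : H -> V -> R^o) (y0 : H) (y : R -> H) : Prop :=
  [/\ {within `[0, +oo[, continuous y}, y 0 = y0 &
      exists (yV : R -> V) (dy : R -> V -> R^o),
        [/\ {ae mu, forall t, 0 < t -> iota (yV t) = y t},
            forall T : R, 0 < T -> Lp 2 (@enorm R V) `]0, T[ yV,
            forall T : R, 0 < T -> Lp 2 (@dnorm R V) `]0, T[ dy,
            weak_derivative y dy &
            {ae mu, forall t, 0 < t ->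
               dy t + A (yV t) + Arc t (yV t) + N t (yV t)
               = - (lambda *: F (y t))}]].

Definition exp_decay (m : R) (y : R -> H) : Prop :=
  forall s t, 0 <= s -> s <= t -> `|y t| <= expR (- m * (t - s)) * `|y s|.

Definition strictly_decreasing_at (y : R -> H) (s : R) : Prop :=
  forall t, s < t -> `|y t| < `|y s|.

(* every solution with initial state of norm < r is stable with rate m *)
Definition stabilizes (A : V -> V -> R^o) (Arc N : R -> V -> V -> R^o)
    (lambda : R) (F : H -> V -> R^o) (r m : R) : Prop :=
  forall (y0 : H) (y : R -> H), `|y0| < r ->
    weak_solution A Arc N lambda F y0 y ->
    exp_decay m y /\
    (forall s, 0 <= s -> `|y s| != 0 -> strictly_decreasing_at y s).

End Setting.

(* the functions C_{[a1,a2,a3,a4]}, on nonnegative arguments *)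
Definition nondecreasing4 (R : realType) d (T : porderType d)
    (f : R -> R -> R -> R -> T) : Prop :=
  forall a1 a2 a3 a4 b1 b2 b3 b4 : R,
    0 <= a1 <= b1 -> 0 <= a2 <= b2 -> 0 <= a3 <= b3 -> 0 <= a4 <= b4 ->
    (f a1 a2 a3 a4 <= f b1 b2 b3 b4)%O.

(* Main.v *)
Require Import Defs.
From mathcomp Require Import ring lra measurable_realfun.
Import Order.TTheory GRing.Theory Num.Theory.
Import numFieldNormedType.Exports.
Local Open Scope classical_set_scope.
Local Open Scope ring_scope.

Set Implicit Arguments.
Unset Strict Implicit.
Unset Printing Implicit Defensive.

(** Testing the equation with the solution gives, for almost every time,
    [d/dt |y|^2 / 2 = - |y|_V^2 - <Arc y, y> - <N y, y> - lambda <F y, y>].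
    By Young's inequality the reaction and the nonlinear term cost at most half
    of [|y|_V^2] and a multiple of [|y|_H^2]; for the nonlinear term that
    multiple depends on a bound for [|y|_H], and the exponents
    [zeta2 + delta2 < 1] and [delta1 + delta2 >= 1] are what makes it
    quadratic ([reaction_bound], [nonlin_bound]).

    The multiple of [|y|_H^2] is compensated as follows ([gap_estimate]). Let
    [q] be the oblique projection of [y] on the auxiliary space along the
    orthogonal of the actuators. The remainder [y - q] is orthogonal to the
    actuators, so [|y - q|_V^2] is at least [xi_M |y - q|_H^2] with [xi_M] large
    for large [M]. The component [q] lives in a finite-dimensional space on
    which both feedback operators are coercive, with a constant that depends on
    [M] only ([feedback_coercive]); a large [lambda] takes care of it. This
    gives dissipation at rate [mu + 1] as long as [|y|_H <= r + 1]. The constants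
    involved are explicit and monotone, and so are the least index [M] with a
    sufficient gap and the sum of the gains up to that index.

    That a weak solution may be tested with itself is proved in coordinates
    ([energy_decrement]). Along an eigenvector the weak derivative is the
    derivative of a continuous real function, so it integrates to its increments
    ([weak_derivative_integral]) and satisfies the product rule
    ([sqr_increment]). The sum over the eigenvectors passes to the limit by
    dominated convergence ([sum_sqr_increment]): the squares of the norms of the
    state in [V] and of its derivative in the dual are the sums of
    [alpha_k y_k^2] and of [g_k^2 / alpha_k], which dominate the products
    [y_k g_k].

    Finally, decay of [|y|_H^2] over short times propagates along chains of short
    intervals ([interval_chain]), and a solution that starts below [r] stays
    below [r] because decay holds up to [r + 1] ([dissipation_exp_decay]). *)

(** * Finite-dimensional linear algebra *)

Section LinearAlgebra.
Context (R : realType).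

(** A square system whose rows are independent is invertible, so it is solvable
    and its columns are independent too; all the projections below come from
    such systems of scalar products. *)
Lemma injective_system (m : nat) (G : 'I_m -> 'I_m -> R) :
  (forall c : 'I_m -> R, (forall j, \sum_(i < m) c i * G i j = 0) ->
     forall i, c i = 0) ->
  (forall r : 'I_m -> R, exists c : 'I_m -> R,
     forall j, \sum_(i < m) c i * G i j = r j) /\
  (forall c : 'I_m -> R, (forall i, \sum_(j < m) G i j * c j = 0) ->
     forall j, c j = 0).
Proof.
move=> inj; pose M : 'M[R]_m := \matrix_(i, j) G i j.
have uM : M \in unitmx.
  rewrite -row_free_unit -kermx_eq0; apply/rowV0P => v /sub_kermxP vM.
  apply/rowP => i; rewrite mxE; apply: (inj (fun i => v 0 i)) => j.
  have := congr1 (fun A : 'rV[R]_m => A 0 j) vM; rewrite !mxE => vMj; rewrite -[RHS]vMj.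
  by apply: eq_bigr => k _; rewrite mxE.
split=> [r|c Gc].
  exists (fun i => ((\row_j r j) *m invmx M) 0 i) => j.
  have := congr1 (fun A : 'rV[R]_m => A 0 j) (mulmxKV uM (\row_j r j)).
  rewrite [X in _ = X]mxE mxE => rj; rewrite -[RHS]rj.
  by apply: eq_bigr => k _; rewrite [M k j]mxE.
have Mc : M *m (\col_j c j) = 0.
  by apply/colP => i; rewrite !mxE -[RHS](Gc i); apply: eq_bigr => k _; rewrite !mxE.
move=> j; have : (\col_j c j) = 0 :> 'cV_m.
  by rewrite -[LHS]mul1mx -(mulVmx uM) -mulmxA Mc mulmx0.
by move/colP => /(_ j); rewrite !mxE.
Qed.

Definition lincomb (E : lmodType R) (m : nat) (b : 'I_m -> E) (c : 'I_m -> R) : E :=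
  \sum_(i < m) c i *: b i.

Definition psd_form (E : lmodType R) (B : E -> E -> R^o) : Prop :=
  [/\ forall y, linear (B y), forall y z, B y z = B z y & forall y, 0 <= B y y].

Section Forms.
Context (E : lmodType R) (B : E -> E -> R^o) (psdB : psd_form B).

Lemma formC y z : B y z = B z y. Proof. by case: psdB. Qed.
Lemma form_ge0 y : 0 <= B y y. Proof. by case: psdB. Qed.
Lemma formPr a x y z : B x (a *: y + z) = a * B x y + B x z.
Proof. by case: psdB => + _ _ => ->. Qed.
Lemma form0r x : B x 0 = 0.
Proof. by have := formPr 1 x 0 0; rewrite scale1r addr0 mul1r; lra. Qed.
Lemma formZr a x y : B x (a *: y) = a * B x y.
Proof. by have := formPr a x y 0; rewrite form0r !addr0. Qed.
Lemma formZl a x y : B (a *: y) x = a * B y x.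
Proof. by rewrite formC formZr formC. Qed.
Lemma formDr x y z : B x (y + z) = B x y + B x z.
Proof. by have := formPr 1 x y z; rewrite scale1r mul1r. Qed.
Lemma formBr x y z : B x (y - z) = B x y - B x z.
Proof. by rewrite formDr -scaleN1r formZr mulN1r. Qed.
Lemma formBl x y z : B (y - z) x = B y x - B z x.
Proof. by rewrite formC formBr formC (formC x). Qed.
Lemma form_sumr (I : Type) (r : seq I) (P : pred I) (F : I -> E) x :
  B x (\sum_(i <- r | P i) F i) = \sum_(i <- r | P i) B x (F i).
Proof.
elim/big_rec2: _ => [|i u v _ <-]; first exact: form0r.
exact: formDr.
Qed.
Lemma form_suml (I : Type) (r : seq I) (P : pred I) (F : I -> E) x :
  B (\sum_(i <- r | P i) F i) x = \sum_(i <- r | P i) B (F i) x.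
Proof. by rewrite formC form_sumr; apply: eq_bigr => i _; exact: formC. Qed.

(** Expanding the form at a combination of [x] and [y] orthogonal to [y] gives
    the inequality when one of the two vectors is not isotropic; two isotropic
    vectors are handled by [x - B(x,y) y]. *)
Lemma form_CS x y : B x y ^+ 2 <= B x x * B y y.
Proof.
have key u v : 0 <= B v v * (B u u * B v v - B u v ^+ 2).
  have := form_ge0 (B v v *: u - B u v *: v).
  rewrite formBl !formBr !formZl !formZr (formC v u).
  by congr (_ <= _); ring.
have kx := key x y; have ky := key y x; rewrite formC in ky.
have [y0|ny0] := eqVneq (B y y) 0; last first.
  have yp : 0 < B y y by rewrite lt_def ny0 form_ge0.
  by rewrite pmulr_rge0 // in kx; lra.
have [x0|nx0] := eqVneq (B x x) 0; last first.
  have xp : 0 < B x x by rewrite lt_def nx0 form_ge0.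
  by rewrite pmulr_rge0 // in ky; lra.
have := form_ge0 (x - B x y *: y).
rewrite formBl !formBr !formZl !formZr (formC y x) x0 y0; lra.
Qed.

(** On the span of finitely many vectors a positive definite form dominates the
    coordinates: each coordinate is the product with a vector of the span,
    given by the inverse Gram matrix, and Cauchy-Schwarz applies. *)
Lemma form_dominates_coords (m : nat) (b : 'I_m -> E) :
  (forall c, B (lincomb b c) (lincomb b c) = 0 -> forall i, c i = 0) ->
  exists2 K : R, 0 <= K & forall c : 'I_m -> R,
    \sum_(i < m) c i ^+ 2 <= K * B (lincomb b c) (lincomb b c).
Proof.
move=> posB.
have [|solve _] := @injective_system m (fun i j => B (b i) (b j)).
  move=> c cG; apply: posB; rewrite /lincomb form_sumr big1// => j _.
  rewrite formZr form_suml.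
  under eq_bigr do rewrite formZl.
  by rewrite cG mulr0.
have [d dP] := choice (fun i => solve (fun j => (i == j)%:R)).
pose D i := lincomb b (d i).
exists (\sum_i B (D i) (D i)) => [|c]; first by apply: sumr_ge0 => i _; exact: form_ge0.
rewrite mulr_suml; apply: ler_sum => i _.
set x := lincomb b c; suff -> : c i = B (D i) x by exact: form_CS.
rewrite /x /lincomb form_sumr (bigD1 i)//= big1 => [|j ji]; rewrite formZr /D /lincomb form_suml.
  under eq_bigr do rewrite formZl.
  by rewrite dP eqxx mulr1 addr0.
under eq_bigr do rewrite formZl.
by rewrite dP eq_sym (negbTE ji) mulr0.
Qed.

End Forms.
End LinearAlgebra.

(** * Negligible sets *)

Section NullSets.
Context (R : realType).
Local Notation mu := (@lebesgue_measure R).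
Import HBNNSimple.

(** The Borel structure is not complete, and data given as almost everywhere
    limits of simple functions need not be measurable. The integral of a
    nonnegative function is still the supremum of the integrals of the simple
    functions below it, and these may be set to zero on [Z]. *)
Lemma null_le_integral (D Z : set R) (f g : R -> \bar R) :
  measurable Z -> mu Z = 0%E ->
  (forall x, D x -> (0 <= f x)%E) -> (forall x, D x -> (0 <= g x)%E) ->
  (forall x, D x -> ~ Z x -> (f x <= g x)%E) ->
  (\int[mu]_(x in D) f x <= \int[mu]_(x in D) g x)%E.
Proof.
move=> mZ Z0 f0 g0 fg; rewrite integral_mkcond [leRHS]integral_mkcond.
have res0 (h : R -> \bar R) : (forall x, D x -> (0 <= h x)%E) -> forall x, (0 <= (h \_ D) x)%E.
  by move=> h0 x; rewrite patchE; case: ifPn => // /set_mem; exact: h0.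
rewrite ge0_integralTE; last exact: res0.
apply: ge_ereal_sup => _ [h hf <-].
rewrite -integralT_nnsfun.
have hh : forall x, (0 <= (EFin \o h) x)%E by move=> x; rewrite lee_fin.
rewrite (@ge0_negligible_integral _ _ _ mu setT Z)//; last first.
  - by move=> x _; exact: hh.
  - by apply/measurable_EFinP; exact: measurable_funPT.
rewrite setTD integral_mkcond.
rewrite [X in (X <= _)%E](_ : _ = \int[mu]_x (EFin \o proj_nnsfun h (measurableC mZ)) x)%E.
  rewrite integralT_nnsfun [leRHS]ge0_integralTE; last exact: res0.
  apply: ereal_sup_ubound; exists (proj_nnsfun h (measurableC mZ)) => // x.
  rewrite -mrestrict patchE; case: ifPn => [/set_mem Zx|_]; last exact: res0.
  apply: le_trans (hf x) _; rewrite !patchE; case: ifPn => // /set_mem Dx.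
  exact: fg.
apply: eq_integral => x _; rewrite /comp -mrestrict !patchE; by case: ifPn.
Qed.

Lemma null_eq_integral (D Z : set R) (f g : R -> \bar R) :
  measurable Z -> mu Z = 0%E -> (forall x, D x -> ~ Z x -> f x = g x) ->
  (\int[mu]_(x in D) f x = \int[mu]_(x in D) g x)%E.
Proof.
move=> mZ Z0 fg; rewrite integralE [RHS]integralE; congr (_ - _)%E;
  apply/eqP; rewrite eq_le; apply/andP; split;
  by apply: (null_le_integral mZ Z0) => // x Dx Zx; rewrite !(funeposE, funenegE) fg.
Qed.

End NullSets.

(** * Chains of intervals and a smooth step *)

Section Calculus.
Context (R : realType).
Local Notation mu := (@lebesgue_measure R).

(** A transitive relation that holds locally around each point holds between
    the endpoints: otherwise the supremum of the points reached from [a] could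
    be passed. It stands in for uniform continuity and for continuation in
    time. *)
Lemma interval_chain (P : R -> R -> Prop) (a b : R) : a <= b ->
  (forall x y z, a <= x -> x <= y -> y <= z -> z <= b ->
     P x y -> P y z -> P x z) ->
  (forall x, a <= x <= b -> exists2 d : R, 0 < d & forall u v,
     a <= u -> u <= x -> x <= v -> v <= b -> v - u < d -> P u v) ->
  P a b.
Proof.
move=> ab Ptr Ploc.
pose S : set R := [set c | a <= c <= b /\ P a c].
have Sa : S a.
  split; first by rewrite lexx.
  have [|d d0 dP] := Ploc a; first by rewrite lexx.
  by apply: dP => //; rewrite subrr.
have ubS : ubound S b by move=> c [/andP[]].
have supS : has_sup S by split; [exists a|exists b].
have ac : a <= sup S by apply: ub_le_sup => //; case: supS.
have cb : sup S <= b by apply: ge_sup => //; case: supS.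
have [|d d0 dP] := Ploc (sup S); first by rewrite ac cb.
have d20 : 0 < d / 2 by lra.
have [e Se ec] := sup_adherent d20 supS.
have ec' : e <= sup S by apply: ub_le_sup => //; case: supS.
have [/andP[ae eb] Pe] := Se.
pose f := Num.min b (sup S + d / 4).
have cf : sup S <= f by rewrite /f le_min cb/=; lra.
have fd : f <= sup S + d / 4 by rewrite /f ge_min lexx orbT.
have fb : f <= b by rewrite /f ge_min lexx.
have Pf : P a f.
  apply: (Ptr _ e) => //; first by lra.
  by apply: dP => //; lra.
have fc : f <= sup S.
  by apply: ub_le_sup; [case: supS|split => //; rewrite fb andbT; lra].
suff <- : f = b by [].
move: fc; rewrite /f; case: (lerP b (sup S + d / 4)) => //; lra.
Qed.

(** [step] is the primitive of the tent [bump], of height 2 on the unit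
    interval: a continuously differentiable passage from 0 to 1. *)
Definition ramp (x : R) : R := Num.max 0 x.
Definition bump (x : R) : R^o := 4 * ramp x - 8 * ramp (x - 2^-1) + 4 * ramp (x - 1).
Definition step (x : R) : R^o :=
  2 * ramp x ^+ 2 - 4 * ramp (x - 2^-1) ^+ 2 + 2 * ramp (x - 1) ^+ 2.

Lemma rampE x : (x <= 0 /\ ramp x = 0) \/ (0 <= x /\ ramp x = x).
Proof.
rewrite /ramp; case: (leP 0 x) => x0; [right|left]; split=> //; exact: ltW.
Qed.

Lemma ramp_sq_taylor x h :
  `|ramp (x + h) ^+ 2 - ramp x ^+ 2 - h * (2 * ramp x)| <= h ^+ 2.
Proof.
rewrite ler_norml; case: (rampE x) => -[x0 ->]; case: (rampE (x + h)) => -[xh ->];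
apply/andP; split; nra.
Qed.

Lemma step0 x : x <= 0 -> step x = 0.
Proof.
move=> x0; rewrite /step; case: (rampE x) => -[? ->];
case: (rampE (x - 2^-1)) => -[? ->]; case: (rampE (x - 1)) => -[? ->]; nra.
Qed.

Lemma step1 x : 1 <= x -> step x = 1.
Proof.
move=> x0; rewrite /step; case: (rampE x) => -[? ->]; [lra|].
case: (rampE (x - 2^-1)) => -[? ->]; [lra|].
case: (rampE (x - 1)) => -[? ->]; [|by field].
have -> : x = 1 by lra.
by field.
Qed.

Lemma step_ge0_le1 x : 0 <= step x <= 1.
Proof.
rewrite /step; case: (rampE x) => -[? ->];
case: (rampE (x - 2^-1)) => -[? ->]; case: (rampE (x - 1)) => -[? ->];
apply/andP; split; nra.
Qed.

Lemma bump_ge0 x : 0 <= bump x.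
Proof.
rewrite /bump; case: (rampE x) => -[? ->];
case: (rampE (x - 2^-1)) => -[? ->]; case: (rampE (x - 1)) => -[? ->]; lra.
Qed.

Lemma bump_out x : x <= 0 \/ 1 <= x -> bump x = 0.
Proof.
rewrite /bump; case: (rampE x) => -[? ->];
case: (rampE (x - 2^-1)) => -[? ->]; case: (rampE (x - 1)) => -[? ->]; lra.
Qed.

Lemma continuous_ramp : continuous ramp.
Proof. by move=> x; apply: continuous_max => //; exact: cvg_cst. Qed.

Lemma continuous_bump : continuous bump.
Proof.
have cr (c : R) : continuous (fun x : R => ramp (x - c)).
  move=> x; apply: (@continuous_comp _ _ _ (fun x : R => x - c) ramp); last exact: continuous_ramp.
  by apply: cvgB => //; exact: cvg_cst.
move=> x; apply: cvgD; [apply: cvgB|]; apply: cvgM => //; try exact: cvg_cst;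
 [exact: continuous_ramp|exact: cr|exact: cr].
Qed.

(** The quadratic remainder of [ramp_sq_taylor] gives the derivative at the kink
    0 and elsewhere at once. *)
Lemma is_derive_ramp_sq (x : R) :
  is_derive x (1 : R^o) (fun y => ramp y ^+ 2 : R^o) (2 * ramp x).
Proof.
suff D : h^-1 *: ((fun y => ramp y ^+ 2 : R^o) (h *: (1 : R^o) + x)
    - ramp x ^+ 2) @[h --> 0^'] --> (2 * ramp x : R^o).
  by apply: DeriveDef; [apply/cvg_ex; eexists; exact: D|exact/cvg_lim].
apply/cvgrPdist_le => /= e /= e0; near=> h.
have h0 : h != 0 by near: h; exact: nbhs_dnbhs_neq.
have -> : 2 * ramp x - h^-1 *: (ramp (h *: (1 : R^o) + x) ^+ 2 - ramp x ^+ 2) =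
  - h^-1 * (ramp (x + h) ^+ 2 - ramp x ^+ 2 - h * (2 * ramp x)).
  have fld (a b c : R) : c - h^-1 * (a - b) = - h^-1 * (a - b - h * c) by field.
  by rewrite [h *: _]mulr1 (addrC h x); exact: fld.
rewrite normrM normrN normfV mulrC ler_pdivrMr ?normr_gt0//.
apply: le_trans (ramp_sq_taylor x h) _.
rewrite -(real_normK (num_real h)) expr2 ler_wpM2r//.
near: h; apply: dnbhs0_le; exact: e0.
Unshelve. all: by end_near. Qed.

Lemma is_derive_step (x : R) : is_derive x (1 : R^o) step (bump x).
Proof.
have sq (c : R) : is_derive x (1 : R^o) (fun y => ramp (y - c) ^+ 2 : R^o) (2 * ramp (x - c)).
  pose shift := (fun y : R => y - c).
  have D1 := is_derive_ramp_sq (shift x).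
  have D2 : is_derive x (1 : R^o) (shift : R^o -> R^o) 1.
    by apply: is_derive_eq; rewrite subr0.
  by have := is_derive1_comp D1 D2; rewrite mulr1.
have D0 := is_derive_ramp_sq x; have D1 := sq 2^-1; have D2 := sq 1.
have D := @is_deriveD _ _ _ _ _ _ _ _ _
  (@is_deriveB _ _ _ _ _ _ _ _ _ (@is_deriveZ _ _ _ _ 2 _ _ _ D0)
  (@is_deriveZ _ _ _ _ 4 _ _ _ D1)) (@is_deriveZ _ _ _ _ 2 _ _ _ D2).
apply: (@is_derive_eq _ _ _ _ _ _ _ _ D).
have fld (a b c : R) : 2 * (2 * a) - 4 * (2 * b) + 2 * (2 * c) =
  4 * a - 8 * b + 4 * c by ring.
exact: fld.
Qed.

End Calculus.

(** * Weak derivatives of real functions *)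

Section WeakDerivatives.
Context (R : realType).
Local Notation mu := (@lebesgue_measure R).
Local Notation Rpos := (`]0, +oo[%classic : set R).

Lemma continuous_mulf (f g : R -> R) : continuous f -> continuous g ->
  continuous (fun x => f x * g x).
Proof. by move=> cf cg x; apply: (continuousM (cf x)); exact: cg. Qed.

Lemma continuous_subf (f g : R -> R) : continuous f -> continuous g ->
  continuous (fun x => f x - g x).
Proof. by move=> cf cg x; apply: (continuousB (cf x)); exact: cg. Qed.

Lemma continuous_normf (f : R -> R) : continuous f -> continuous (fun x => `|f x|).
Proof. by move=> cf x; apply: cvg_norm; exact: cf. Qed.

Lemma continuous_constf (c : R) : continuous (fun _ : R => c).
Proof. by move=> x; exact: cvg_cst. Qed.

Lemma integrable_scale (D : set R) (c : R) (f : R -> R) : measurable D ->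
  mu.-integrable D (EFin \o f) -> mu.-integrable D (EFin \o (fun x => c * f x)).
Proof.
move=> mD fi; rewrite (_ : _ \o _ = (fun x => c%:E * (f x)%:E)%E)//.
exact: integrableZl.
Qed.

Lemma integrable_sub (D : set R) (f g : R -> R) : measurable D ->
  mu.-integrable D (EFin \o f) -> mu.-integrable D (EFin \o g) ->
  mu.-integrable D (EFin \o (fun x => f x - g x)).
Proof.
move=> mD fi gi; rewrite (_ : _ \o _ = (fun x => (f x)%:E - (g x)%:E)%E)//.
exact: integrableB.
Qed.

Definition step_at (n : nat) (s x : R) : R^o := step ((x - s) * n.+1%:R).
Definition bump_at (n : nat) (s x : R) : R^o := bump ((x - s) * n.+1%:R) * n.+1%:R.

Lemma is_derive_step_at n s (x : R) :
  is_derive x (1 : R^o) (step_at n s) (bump_at n s x).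
Proof.
pose g (y : R) : R := (y - s) * n.+1%:R.
have D2 : is_derive x (1 : R^o) (g : R^o -> R^o) n.+1%:R.
  apply: is_derive_eq; rewrite subr0 scaler0 add0r.
  exact: mulr1.
exact: (is_derive1_comp (is_derive_step (g x)) D2).
Qed.

Lemma continuous_bump_at n s : continuous (bump_at n s).
Proof.
have c1 : continuous (fun y : R => (y - s) * n.+1%:R).
  move=> x; apply: cvgM; last exact: cvg_cst.
  by apply: cvgB => //; exact: cvg_cst.
have c2 : continuous (fun y : R => bump ((y - s) * n.+1%:R)).
  by move=> x; exact: (continuous_comp (c1 x) (@continuous_bump _ _)).
by move=> x; apply: (continuousM (c2 x)); exact: cvg_cst.
Qed.

Lemma continuous_step_at n s : continuous (step_at n s).
Proof.
move=> x; apply/differentiable_continuous/derivable1_diffP.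
by have [] := is_derive_step_at n s x.
Qed.

Lemma continuous_integrable (f : R -> R) (a b : R) : continuous f ->
  mu.-integrable `[a, b] (EFin \o f).
Proof.
move=> cf; apply: continuous_compact_integrable; first exact: segment_compact.
exact/continuous_subspaceT.
Qed.

Lemma step_at0 n (s x : R) : x <= s -> step_at n s x = 0.
Proof. by move=> xs; apply: step0; rewrite mulr_le0_ge0// subr_le0. Qed.

Lemma step_at1 n (s x : R) : 1 <= (x - s) * n.+1%:R -> step_at n s x = 1.
Proof. exact: step1. Qed.

Lemma bump_at_ge0 n (s x : R) : 0 <= bump_at n s x.
Proof. by rewrite mulr_ge0// bump_ge0. Qed.

Lemma bump_at_out n (s x : R) :
  x <= s \/ 1 <= (x - s) * n.+1%:R -> bump_at n s x = 0.
Proof.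
move=> xs; rewrite /bump_at bump_out ?mul0r//; case: xs => xs; [left|by right].
by rewrite mulr_le0_ge0// subr_le0.
Qed.

Lemma bump_at_int n s : \int[mu]_(x in `[s, s + 1]) bump_at n s x = 1.
Proof.
have D x := is_derive_step_at n s x.
rewrite /Rintegral (@continuous_FTC2 _ _ (step_at n s)).
- rewrite /= (step_at0 _ (lexx s)) step_at1 ?subr0//.
  by rewrite addrAC subrr add0r mul1r ler1n.
- by rewrite ltrDl.
- by apply/continuous_subspaceT => x; exact: continuous_bump_at.
- split=> [x _||]; first by have [] := D x.
  + by apply: cvg_at_right_filter; apply/differentiable_continuous/derivable1_diffP; have [] := D s.
  + by apply: cvg_at_left_filter; apply/differentiable_continuous/derivable1_diffP; have [] := D (s + 1).
- by move=> x _; rewrite derive1E; have [_ ->] := D x.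
Qed.

Lemma Rintegral_eq_support (D D' : set R) (f : R -> R) :
  (forall x, ~ (D x <-> D' x) -> f x = 0) ->
  \int[mu]_(x in D) f x = \int[mu]_(x in D') f x.
Proof.
move=> fD; rewrite Rintegral_mkcond [RHS]Rintegral_mkcond; congr Rintegral.
apply/funext => x; rewrite !patchE.
have [/set_mem Dx|/negP nDx] := boolP (x \in D);
have [/set_mem Dx'|/negP nDx'] := boolP (x \in D') => //.
- by apply: fD => -[/(_ Dx) Dx' _]; apply: nDx'; rewrite inE.
- by apply/esym/fD => -[_ /(_ Dx') Dx]; apply: nDx; rewrite inE.
Qed.

(** The tents have mass 1 and shrink to [s] from the right: a Dirac sequence. *)
Lemma bump_at_cvg (u : R -> R) (s : R) : continuous u -> 0 < s ->
  \int[mu]_(x in Rpos) (bump_at n s x * u x) @[n --> \oo] --> u s.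
Proof.
move=> cu s0; apply/cvgrPdist_le => /= e e0.
have /cvgrPdist_le /(_ e e0) := cu s.
move=> -[d /= d0 du].
near=> n.
have nd : d^-1 <= n.+1%:R.
  near: n; exists (Num.truncn d^-1) => // n /= hn.
  apply: ltW; apply: lt_le_trans (truncnS_gt _) _.
  by rewrite ler_nat ltnS.
have -> : \int[mu]_(x in Rpos) (bump_at n s x * u x)
    = \int[mu]_(x in `[s, s + 1]) (bump_at n s x * u x).
  apply: Rintegral_eq_support => x; rewrite /= !in_itv/= andbT => nx.
  rewrite bump_at_out ?mul0r//.
  have [xs|xs] := leP x s; [by left|right].
  have [xs1|xs1] := leP x (s + 1).
    by exfalso; apply: nx; split=> _; [rewrite ltW|exact: lt_trans xs].
  have n1 : (1 : R) <= n.+1%:R by rewrite ler1n.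
  nra.
have ib : mu.-integrable `[s, s + 1] (EFin \o bump_at n s).
  by apply: continuous_integrable; exact: continuous_bump_at.
have ibu : mu.-integrable `[s, s + 1] (EFin \o (fun x => bump_at n s x * u x)).
  by apply: continuous_integrable; apply: continuous_mulf => //; exact: continuous_bump_at.
have ibd : mu.-integrable `[s, s + 1] (EFin \o (fun x => bump_at n s x * (u s - u x))).
  apply: continuous_integrable; apply: continuous_mulf; first exact: continuous_bump_at.
  by apply: continuous_subf => //; exact: continuous_constf.
have -> : u s - \int[mu]_(x in `[s, s + 1]) (bump_at n s x * u x) =
   \int[mu]_(x in `[s, s + 1]) (bump_at n s x * (u s - u x)).
  rewrite -[X in X - _]mul1r -[X in X * u s - _](bump_at_int n s) -RintegralZr//.
  rewrite -RintegralB//; last first.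
    by apply: continuous_integrable; apply: continuous_mulf; [exact: continuous_bump_at|exact: continuous_constf].
  by apply: eq_Rintegral => x _; rewrite mulrBr.
apply: le_trans (le_normr_Rintegral _ ibd) _ => //.
have -> : e = \int[mu]_(x in `[s, s + 1]) (bump_at n s x * e).
  by rewrite RintegralZr// bump_at_int mul1r.
apply: le_Rintegral => //.
- apply: continuous_integrable; apply: continuous_normf.
  apply: continuous_mulf; first exact: continuous_bump_at.
  by apply: continuous_subf => //; exact: continuous_constf.
- by apply: continuous_integrable; apply: continuous_mulf; [exact: continuous_bump_at|exact: continuous_constf].
move=> x /=; rewrite in_itv/= => /andP[sx xs1].
rewrite normrM ger0_norm ?bump_at_ge0//.
have [xd|xd] := ltP (x - s) d.
  rewrite ler_wpM2l ?bump_at_ge0//; apply: du => /=.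
  by rewrite distrC ger0_norm ?subr_ge0.
rewrite bump_at_out ?mul0r//; right.
rewrite -[X in X <= _](mulfV (lt0r_neq0 d0)); apply: ler_pM => //; first exact: ltW.
by rewrite invr_ge0 ltW.
Unshelve. all: by end_near. Qed.

Lemma test_function_steps n (s t : R) : 0 < s -> s <= t ->
  test_function (fun x => step_at n s x - step_at n t x) /\
  derive1 (fun x => step_at n s x - step_at n t x : R^o) =
    (fun x => bump_at n s x - bump_at n t x).
Proof.
move=> s0 st.
have D x := is_deriveB (is_derive_step_at n s x) (is_derive_step_at n t x).
have D1 : derive1 (fun x => step_at n s x - step_at n t x : R^o) =
    (fun x => bump_at n s x - bump_at n t x).
  by apply/funext => x; rewrite derive1E; have [_ ->] := D x.
split=> //; split.
- by move=> x; have [] := D x.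
- by rewrite D1; apply: continuous_subf; exact: continuous_bump_at.
- exists s, (t + 1); split=> // x; rewrite in_itv/= negb_and -!ltNge => /orP[xs|xt].
    rewrite !step_at0 ?subr0//; lra.
  have n1 : (1 : R) <= n.+1%:R by rewrite ler1n.
  rewrite !step_at1 ?subrr//; nra.
Qed.

(** Du Bois-Reymond: test functions growing steeply from 0 to 1 just after [s]
    and decreasing likewise just after [t] turn the definition of the weak
    derivative [g] into its integral over [s, t]. *)
Lemma weak_derivative_integral (u g : R -> R) (s t : R) :
  0 < s -> s <= t -> continuous u ->
  mu.-integrable `[s, t + 1] (EFin \o g) ->
  (forall phi : R -> R^o, test_function phi ->
    (forall x, ~ (s <= x <= t + 1) -> phi x = 0) ->
    \int[mu]_(x in Rpos) (derive1 phi x * u x)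
    = - \int[mu]_(x in Rpos) (phi x * g x)) ->
  u t - u s = \int[mu]_(x in `[s, t]) g x.
Proof.
move=> s0 st cu ig weak.
have t0 : 0 < t by lra.
pose phi n (x : R) : R^o := step_at n s x - step_at n t x.
have lim1 : \int[mu]_(x in Rpos) (derive1 (phi n) x * u x) @[n --> \oo] --> u s - u t.
  have L := cvgB (bump_at_cvg cu s0) (bump_at_cvg cu t0).
  rewrite (_ : (fun n => _) = (fun n => \int[mu]_(x in Rpos) (bump_at n s x * u x)
    - \int[mu]_(x in Rpos) (bump_at n t x * u x))); first exact: L.
  apply/funext => n.
  have [_ ->] := test_function_steps n s0 st.
  have sup (r : R) : 0 < r -> s <= r -> r <= t -> \int[mu]_(x in Rpos) (bump_at n r x * u x)
      = \int[mu]_(x in `[s, t + 1]) (bump_at n r x * u x).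
    move=> r0 sr rt; apply: Rintegral_eq_support => x; rewrite /= !in_itv/= andbT => nx.
    rewrite bump_at_out ?mul0r//.
    have [xs|xs] := leP x r; [by left|right].
    have [xs1|xs1] := leP x (t + 1).
      by exfalso; apply: nx; split=> _; [apply/andP; split; lra|lra].
    have n1 : (1 : R) <= n.+1%:R by rewrite ler1n.
    nra.
  have ib r : mu.-integrable `[s, t + 1] (EFin \o (fun x => bump_at n r x * u x)).
    by apply: continuous_integrable; apply: continuous_mulf => //; exact: continuous_bump_at.
  rewrite !sup// -RintegralB//.
  rewrite (@Rintegral_eq_support Rpos `[s, t + 1]).
    by apply: eq_Rintegral => x _; rewrite mulrBl.
  move=> x; rewrite /= !in_itv/= andbT => nx.
  have n1 : (1 : R) <= n.+1%:R by rewrite ler1n.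
  have [xs|xs] := leP x s.
    by rewrite !bump_at_out ?subrr ?mul0r//; left; lra.
  have [xs1|xs1] := leP x (t + 1).
    by exfalso; apply: nx; split=> _; [apply/andP; split; lra|lra].
  by rewrite !bump_at_out ?subrr ?mul0r//; right; nra.
have phi_out n x : x <= s \/ t + 1 <= x -> phi n x = 0.
  have n1 : (1 : R) <= n.+1%:R by rewrite ler1n.
  by move=> [xs|xt]; rewrite /phi; [rewrite !step_at0 ?subrr//; lra|
    rewrite !step_at1 ?subrr//; nra].
have lim2 : \int[mu]_(x in Rpos) (phi n x * g x) @[n --> \oo] -->
    \int[mu]_(x in `[s, t]) g x.
  have phi1 n x : `|phi n x| <= 1.
    have n1 : (1 : R) <= n.+1%:R by rewrite ler1n.
    have /andP[? ?] := step_ge0_le1 ((x - s) * n.+1%:R).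
    have /andP[? ?] := step_ge0_le1 ((x - t) * n.+1%:R).
    rewrite ler_norml /phi /step_at; apply/andP; split; lra.
  have phi_lim x : s <= x <= t + 1 -> (phi n x * g x) @[n --> \oo] --> (g \_ `]s, t]) x.
    move=> /andP[sx xt]; rewrite patchE mem_setE in_itv/=.
    case: ifPn => [/andP[sx' xt']|].
      apply: cvg_near_cst; near=> n.
      rewrite /phi (@step_at0 n t)// subr0 step_at1 ?mul1r//.
      rewrite -ler_pdivrMl ?subr_gt0// mulr1; near: n.
      exists (Num.truncn (x - s)^-1) => // n /= hn.
      by apply: ltW; apply: lt_le_trans (truncnS_gt _) _; rewrite ler_nat ltnS.
    rewrite negb_and -leNgt -ltNge => /orP[xs|tx].
      by apply: cvg_near_cst; near=> n; rewrite phi_out ?mul0r//; left.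
    apply: cvg_near_cst; near=> n; rewrite /phi.
    have tn : 1 <= (x - t) * n.+1%:R.
      rewrite -ler_pdivrMl ?subr_gt0// mulr1; near: n.
      exists (Num.truncn (x - t)^-1) => // n /= hn.
      by apply: ltW; apply: lt_le_trans (truncnS_gt _) _; rewrite ler_nat ltnS.
    rewrite !step_at1 ?subrr ?mul0r//.
    by apply: le_trans tn _; rewrite ler_wpM2r// lerB.
  have mD : measurable (`[s, t + 1]%classic : set R) by exact: measurable_itv.
  have mg : measurable_fun `[s, t + 1] g.
    by apply/measurable_EFinP; exact: measurable_int ig.
  have mphi n : measurable_fun `[s, t + 1] (phi n).
    apply: measurable_funTS; apply: continuous_measurable_fun.
    by apply: continuous_subf; exact: continuous_step_at.
  have ign : mu.-integrable `[s, t + 1] (EFin \o (fun x => `|g x|)).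
    exact: integrable_norm.
  have igst : mu.-integrable `]s, t] (EFin \o g).
    apply: integrableS ig => //; apply: subset_itv; rewrite bnd_simp//.
    by rewrite lerDl.
  have sub : `[s, t + 1]%classic `&` `]s, t]%classic = `]s, t]%classic :> set R.
    apply/seteqP; split=> x /=; rewrite !in_itv/=; first by case.
    by move=> /andP[sx xt]; split; apply/andP; split; lra.
  have igr : mu.-integrable `[s, t + 1] (EFin \o (g \_ `]s, t])).
    rewrite -restrict_EFin; apply/(integrable_restrict _ _ _).
    - exact: measurable_itv.
    - exact: mD.
    - by rewrite sub.
  have mphig n : measurable_fun `[s, t + 1] (fun x => (phi n x * g x)%:E).
    by apply/measurable_EFinP; apply: measurable_funM.
  have := @dominated_cvg _ _ _ mu `[s, t + 1] mD
    (fun n x => (phi n x * g x)%:E) (EFin \o (g \_ `]s, t]))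
    (EFin \o (fun x => `|g x|)) mphig _ _ ign _.
  rewrite -Rintegral_itv_obnd_cbnd//.
  have -> : \int[mu]_(x in `]s, t]) g x = \int[mu]_(x in `[s, t + 1]) (g \_ `]s, t]) x.
    by rewrite -Rintegral_mkcondr sub.
  have -> : (fun n => \int[mu]_(x in Rpos) (phi n x * g x)) =
      (fun n => \int[mu]_(x in `[s, t + 1]) (phi n x * g x)).
    apply/funext => n; apply: Rintegral_eq_support => x /=; rewrite !in_itv/= andbT => nx.
    have [xs|xs] := leP x s; first by rewrite phi_out ?mul0r//; left.
    have [xt|xt] := leP x (t + 1); last by rewrite phi_out ?mul0r//; right; exact: ltW.
    by exfalso; apply: nx; split=> _; [rewrite xt ltW|lra].
  move=> lim; apply: fine_cvg; rewrite fineK; last exact: integrable_fin_num.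
  apply: lim => //.
  - move=> x /=; rewrite in_itv/= => /phi_lim px.
    by apply: cvg_EFin; [exact: nearW|exact: px].
  - move=> n x _; rewrite /= lee_fin normrM.
    by apply: ler_piMl.
have lim3 : \int[mu]_(x in Rpos) (derive1 (phi n) x * u x) @[n --> \oo] -->
    - \int[mu]_(x in `[s, t]) g x.
  rewrite (_ : (fun n => _) = (fun n => - \int[mu]_(x in Rpos) (phi n x * g x))).
    exact: cvgN.
  apply/funext => n; apply: (weak _ (test_function_steps n s0 st).1) => x xst.
  have [xs|xs] := leP x s; first by apply: phi_out; left.
  by apply: phi_out; right; rewrite leNgt; apply/negP => xt; apply: xst; rewrite !ltW.
have := cvg_lim (@Rhausdorff R) lim1; rewrite (cvg_lim (@Rhausdorff R) lim3) => e.
by rewrite -opprB -e opprK.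
Unshelve. all: by end_near. Qed.

Lemma Rintegral_itv_split (f : R -> R) (a b c : R) : a <= b -> b <= c ->
  mu.-integrable `[a, c] (EFin \o f) ->
  \int[mu]_(x in `[a, c]) f x =
  \int[mu]_(x in `[a, b]) f x + \int[mu]_(x in `[b, c]) f x.
Proof.
move=> ab bc fi.
have := @Rintegral_itvB _ f (BLeft a) (BRight c) b fi.
rewrite !bnd_simp => /(_ ab bc).
rewrite Rintegral_itv_obnd_cbnd; first by move=> <-; rewrite addrC subrK.
apply: integrableS fi => //; apply: subset_itv; rewrite bnd_simp//.
Qed.

(** On a short interval [u(b)^2 - u(a)^2 = (u(b) + u(a)) (u(b) - u(a))] is the
    integral of [(u(b) + u(a)) g], and [u(b) + u(a)] differs little from [2 u];
    the errors add up to a small multiple of the integral of [|g|]. *)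
Lemma sqr_increment (u g : R -> R) (s t : R) : s <= t -> continuous u ->
  mu.-integrable `[s, t] (EFin \o g) ->
  (forall a b, s <= a -> a <= b -> b <= t ->
     u b - u a = \int[mu]_(x in `[a, b]) g x) ->
  mu.-integrable `[s, t] (EFin \o (fun x => u x * g x)) /\
  u t ^+ 2 - u s ^+ 2 = 2 * \int[mu]_(x in `[s, t]) (u x * g x).
Proof.
move=> st cu ig ug.
have mg : measurable_fun `[s, t] g.
  by apply/measurable_EFinP; exact: measurable_int ig.
have mu_ : measurable_fun `[s, t] u.
  by apply: measurable_funTS; exact: continuous_measurable_fun.
have ign : mu.-integrable `[s, t] (EFin \o (fun x => `|g x|)) by exact: integrable_norm.
have [K K0 uK] : exists2 K : R, 0 <= K & forall x, x \in `[s, t] -> `|u x| <= K.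
  have [c cst cP] := @EVT_max _ (fun x => `|u x|) s t st (continuous_subspaceT (continuous_normf cu)).
  by exists `|u c|.
have iug : mu.-integrable `[s, t] (EFin \o (fun x => u x * g x)).
  apply: (@le_integrable _ _ _ mu `[s, t] _ _ (EFin \o (fun x => K * `|g x|))) => //.
  - by apply/measurable_EFinP; exact: measurable_funM.
  - move=> x xst; rewrite /= lee_fin normrM [leRHS]ger0_norm ?mulr_ge0//.
    by rewrite ler_wpM2r// uK.
  - exact: integrable_scale.
split=> //.
have sub a b : s <= a -> b <= t -> `[a, b]%classic `<=` (`[s, t]%classic : set R).
  by move=> sa bt; apply: subset_itv; rewrite bnd_simp.
have int f a b : mu.-integrable `[s, t] (EFin \o f) -> s <= a -> b <= t ->
    mu.-integrable `[a, b] (EFin \o f).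
  by move=> fi sa bt; apply: integrableS fi => //; exact: sub.
set I := \int[mu]_(x in `[s, t]) (u x * g x).
set J := \int[mu]_(x in `[s, t]) `|g x|.
have J0 : 0 <= J by apply: Rintegral_ge0.
suff key (e : R) : 0 < e -> `|u t ^+ 2 - u s ^+ 2 - 2 * I| <= e * J.
  apply/eqP; rewrite -subr_eq0 -normr_le0; apply/ler_addgt0Pr => e e0.
  have J1 : 0 < J + 1 by lra.
  rewrite add0r; apply: le_trans (key (e / (J + 1)) _) _; first by rewrite divr_gt0.
  by rewrite mulrAC ler_pdivrMr// ler_wpM2l ?ltW//; lra.
move=> e0; rewrite /I /J.
pose P (a b : R) : Prop := `|u b ^+ 2 - u a ^+ 2 - 2 * \int[mu]_(x in `[a, b]) (u x * g x)| <=
  e * \int[mu]_(x in `[a, b]) `|g x|.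
suff : P s t by [].
apply: (@interval_chain _ P) => //.
- move=> x y z sx xy yz zt; rewrite /P.
  rewrite (@Rintegral_itv_split _ x y z)//; last exact: int.
  rewrite (@Rintegral_itv_split (fun x => `|g x|) x y z)//; last exact: int.
  rewrite !ler_norml => /andP[? ?] /andP[? ?]; apply/andP; split; lra.
- move=> x /andP[sx xt].
  have e4 : 0 < e / 4 by lra.
  have /cvgrPdist_le /(_ _ e4) := cu x.
  move=> -[d /= d0 du]; exists d => // a b sa ax xb bt bad.
  have near_x z : a <= z <= b -> `|u x - u z| <= e / 4.
    move=> /andP[az zb]; apply: du => /=.
    by rewrite ltr_norml; apply/andP; split; lra.
  have ab : a <= b by lra.
  rewrite /P; have -> : u b ^+ 2 - u a ^+ 2 = (u b + u a) * (u b - u a) by ring.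
  rewrite ug// -RintegralZl//; last exact: int.
  rewrite -RintegralZl//; last exact: int.
  have iA : mu.-integrable `[a, b] (EFin \o (fun x => (u b + u a) * g x)).
    by apply: integrable_scale => //; exact: int.
  have iB : mu.-integrable `[a, b] (EFin \o (fun x => 2 * (u x * g x))).
    by apply: integrable_scale => //; exact: int.
  have iC : mu.-integrable `[a, b] (EFin \o (fun x => (u b + u a) * g x - 2 * (u x * g x))).
    exact: integrable_sub.
  rewrite -[2 * _]RintegralZl//; last exact: int.
  rewrite -RintegralB//; apply: le_trans (le_normr_Rintegral _ iC) _ => //.
  apply: le_Rintegral => //.
  + by have := integrable_norm iC.
  + by apply: integrable_scale => //; exact: int.
  move=> z; rewrite /= in_itv/= => /andP[az zb].
  have -> : (u b + u a) * g z - 2 * (u z * g z) = (u b + u a - 2 * u z) * g z by ring.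
  rewrite normrM ler_wpM2r//.
  have := near_x z; have := near_x a; have := near_x b.
  rewrite az zb ab !lexx/= !ler_norml => /(_ isT)/andP[? ?] /(_ isT)/andP[? ?] /(_ isT)/andP[? ?].
  apply/andP; split; lra.
Qed.

End WeakDerivatives.

(** * Functionals and eigenvector expansions *)

Section DualNorms.
Context (R : realType).

Lemma opnorm_bound (X : normedModType R) (Y : lmodType R) (nY : Y -> \bar R)
    (B : X -> Y) (m : \bar R) : (opnorm nY B < m)%E ->
  exists c : R, [/\ 0 <= c, (c%:E < m)%E, linear B &
    forall x, (nY (B x) <= (c * `|x|)%:E)%E].
Proof.
move=> /ereal_inf_lt[_ [c [c0 lB Bc] <-] cm]; by exists c.
Qed.

Lemma dnorm_linear (V : normedModType R) (f : V -> R^o) :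
  (dnorm f < +oo)%E -> linear f.
Proof. by move=> /opnorm_bound[c [_ _ lf _]]. Qed.

Lemma dnorm_le (V : normedModType R) (f : V -> R^o) (m : R) (v : V) :
  (dnorm f <= m%:E)%E -> `|f v| <= m * `|v|.
Proof.
move=> fm; apply/ler_addgt0Pr => e e0.
have v1 : 0 < `|v| + 1 by rewrite ltr_wpDl.
have /opnorm_bound[c [c0 cm _ /(_ v)]] : (dnorm f < (m + e / (`|v| + 1))%:E)%E.
  by apply: le_lt_trans fm _; rewrite lte_fin ltrDl divr_gt0.
rewrite lee_fin => /le_trans; apply; rewrite lte_fin in cm.
apply: le_trans (ler_wpM2r (normr_ge0 v) (ltW cm)) _.
by rewrite mulrDl lerD2l mulrAC ler_pdivrMr// ler_wpM2l ?ltW// ltrDl.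
Qed.

Lemma dnorm_ge0 (V : normedModType R) (f : V -> R^o) : (0 <= dnorm f)%E.
Proof.
by apply: le_ereal_inf_tmp => _ [c [c0 _ _] <-]; rewrite lee_fin.
Qed.

Lemma le_dnorm (V : normedModType R) (f : V -> R^o) (m : R) : 0 <= m ->
  linear f -> (forall v, `|f v| <= m * `|v|) -> (dnorm f <= m%:E)%E.
Proof.
move=> m0 lf fm; apply: ereal_inf_lbound; by exists m.
Qed.

(** The norms may be infinite along the sequence; they are eventually finite
    since they tend to 0. *)
Lemma dnorm_cvg_eval (V : normedModType R) (f : V -> R^o) (S : nat -> V -> R^o)
    (v : V) :
  dnorm (f - S n) @[n --> \oo] --> 0%E -> S n v @[n --> \oo] --> f v.
Proof.
move=> fS; apply/cvgrPdist_le => /= eps eps0.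
have v1 : 0 < `|v| + 1 by rewrite ltr_wpDl.
have ev : 0 < eps / (`|v| + 1) by rewrite divr_gt0.
move/fine_cvgP : fS => [fin /cvgrPdist_le /(_ _ ev) bound].
near=> n.
have fn : dnorm (f - S n) \is a fin_num by near: n.
have bn : `|0 - fine (dnorm (f - S n))| <= eps / (`|v| + 1) by near: n.
rewrite sub0r normrN ger0_norm ?fine_ge0 ?dnorm_ge0// in bn.
have := @dnorm_le _ (f - S n) (eps / (`|v| + 1)) v.
rewrite -(fineK fn) lee_fin => /(_ bn) => /le_trans; apply.
by rewrite mulrAC ler_pdivrMr// ler_wpM2l ?ltW// ltrDl.
Unshelve. all: by end_near. Qed.

Lemma dnorm_fin_perturb (V : normedModType R) (f g : V -> R^o) :
  (dnorm (f - g)%R < +oo)%E -> (dnorm g < +oo)%E -> (dnorm f < +oo)%E.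
Proof.
move=> /opnorm_bound[c [c0 _ lfg cP]] /opnorm_bound[d [d0 _ lg dP]].
have -> : f = (f - g) + g by rewrite subrK.
apply: le_lt_trans (@le_dnorm _ _ (c + d) _ _ _) (ltry _); first exact: addr_ge0.
  move=> a x y; rewrite !fctE.
  have h1 : f (a *: x + y) - g (a *: x + y) = a * (f x - g x) + (f y - g y).
    exact: lfg.
  have h2 : g (a *: x + y) = a * g x + g y by exact: lg.
  rewrite !subrK; suff : f (a *: x + y) = a * f x + f y by [].
  rewrite -[LHS](subrK (g (a *: x + y))) h1 h2; ring.
move=> v; rewrite fctE mulrDl; apply: le_trans (ler_normD _ _) _; apply: lerD.
  by have := cP v; rewrite lee_fin.
by have := dP v; rewrite lee_fin.
Qed.

End DualNorms.

Section Spectral.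
Context (R : realType) (H V : completeNormedModType R).
Context (dot : {dot H for idfun}) (iota : {linear V -> H}).
Context (A : V -> V -> R^o) (alpha : nat -> R) (e : nat -> V).
Hypothesis H_hilbert : forall h : H, `|h| ^+ 2 = dot h h.
Hypothesis hA1 : assumption_A1 A.
Hypothesis hA2 : assumption_A2 iota.
Hypothesis he : eigenbasis dot iota A alpha e.

Lemma dot_psd : psd_form (dot : H -> H -> R^o).
Proof.
split=> [y a u v|y z|y].
- by rewrite linearP.
- by rewrite (hermC dot) expr0 mul1r.
- by rewrite -H_hilbert sqr_ge0.
Qed.

Lemma energy_psd : psd_form A.
Proof.
have [Afin Asym Anorm] := hA1; split=> // [y|y].
  have /opnorm_bound[c [c0 _ _ Ac]] := Afin.
  by apply: dnorm_linear; apply: le_lt_trans (Ac y) _; rewrite ltry.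
by rewrite Anorm sqr_ge0.
Qed.

Lemma dot_le (x y : H) : `|dot x y| <= `|x| * `|y|.
Proof.
rewrite -ler_sqr ?nnegrE ?mulr_ge0// real_normK ?num_real// exprMn !H_hilbert.
exact: (form_CS dot_psd).
Qed.

Lemma energy_le (x y : V) : `|A x y| <= `|x| * `|y|.
Proof.
have [_ _ Anorm] := hA1.
rewrite -ler_sqr ?nnegrE ?mulr_ge0// real_normK ?num_real// exprMn -!Anorm.
exact: (form_CS energy_psd).
Qed.

Lemma energy_eig k v : A (e k) v = alpha k * dot (iota v) (iota (e k)).
Proof.
have [_ _ eA _ _] := he; rewrite eA /toV' /=.
by rewrite (formC dot_psd).
Qed.

Lemma alpha_gt0 k : 0 < alpha k. Proof. by have [[]] := he. Qed.

Definition coef (h : H) (k : nat) : R := dot h (iota (e k)).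
Definition eig_sum (c : nat -> R) (n : nat) : V := \sum_(0 <= k < n) c k *: e k.
Definition eig_energy (c : nat -> R) (n : nat) : R :=
  \sum_(0 <= k < n) alpha k * c k ^+ 2.

Lemma coef_eig j k : coef (iota (e j)) k = (j == k)%:R.
Proof. by have [_ _ _ ortho _] := he; rewrite /coef ortho. Qed.

Lemma coef_eig_sum c n k : coef (iota (eig_sum c n)) k = if (k < n)%N then c k else 0.
Proof.
rewrite /coef /eig_sum linear_sum (form_suml dot_psd).
under eq_bigr do rewrite linearZ (formZl dot_psd) -/(coef _ _) coef_eig.
rewrite big_mkord; case: ifPn => kn.
  rewrite (bigD1 (Ordinal kn))//= eqxx mulr1 big1 ?addr0// => i ik.
  by rewrite (_ : _ == _ = false) ?mulr0//; apply: contra_neqF ik => /eqP ?; exact: val_inj.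
rewrite big1// => i _; rewrite (_ : _ == _ = false) ?mulr0//.
by apply: contraNF kn => /eqP <-.
Qed.

Lemma energy_eig_sum c n v :
  A (eig_sum c n) v = \sum_(0 <= k < n) alpha k * c k * coef (iota v) k.
Proof.
rewrite /eig_sum (form_suml energy_psd); apply: eq_bigr => k _.
by rewrite (formZl energy_psd) energy_eig /coef mulrCA mulrA.
Qed.

Lemma sqr_norm_eig_sumB c m n : (n <= m)%N ->
  `|eig_sum c m - eig_sum c n| ^+ 2 = eig_energy c m - eig_energy c n.
Proof.
move=> nm; have [_ _ <-] := hA1.
have -> : eig_sum c m - eig_sum c n = eig_sum (fun k => if (k < n)%N then 0 else c k) m.
  rewrite /eig_sum (big_cat_nat (leq0n n) nm)/= [RHS](big_cat_nat (leq0n n) nm)/=.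
  rewrite addrAC subrr add0r [X in X + _]big_nat_cond [X in X + _]big1 ?add0r.
    by rewrite big_nat_cond [RHS]big_nat_cond; apply: eq_bigr => k /andP[/andP[nk _] _];
      rewrite ltnNge nk.
  by move=> k /andP[/andP[_ ->] _]; rewrite scale0r.
rewrite energy_eig_sum /eig_energy (big_cat_nat (leq0n n) nm)/= [X in X - _](big_cat_nat (leq0n n) nm)/=.
rewrite [RHS]addrAC subrr add0r [X in X + _]big_nat_cond [X in X + _]big1 ?add0r.
  rewrite big_nat_cond [RHS]big_nat_cond; apply: eq_bigr => k /andP[/andP[nk km] _].
  by rewrite coef_eig_sum km ltnNge nk/= expr2 mulrA.
by move=> k /andP[/andP[_ ->] _]; rewrite mulr0 mul0r.
Qed.

Lemma eig_energy_nd c : nondecreasing_seq (eig_energy c).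
Proof.
apply/nondecreasing_seqP => n; rewrite /eig_energy big_nat_recr//= lerDl.
by rewrite mulr_ge0 ?sqr_ge0// ltW// alpha_gt0.
Qed.

(** Finite energy makes the partial sums a Cauchy sequence of [V], since the
    eigenvectors are orthogonal for the energy product as well. *)
Lemma eig_sum_cvg c (M : R) : (forall n, eig_energy c n <= M) ->
  cvgn (eig_sum c).
Proof.
move=> cM; apply: cauchy_cvg; apply: cauchy_exP => eps eps0.
have cvgE : cvgn (eig_energy c).
  apply: nondecreasing_is_cvgn; first exact: eig_energy_nd.
  by exists M => _ [n _ <-].
have e2 : 0 < eps ^+ 2 by rewrite exprn_gt0.
have /cvgrPdist_lt /(_ _ e2) [N _ NP] := cvgE.
exists (eig_sum c N); exists N => // n /= Nn.
rewrite -ball_normE /= distrC -ltr_sqr ?nnegrE ?(ltW eps0)// sqr_norm_eig_sumB//.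
apply: le_lt_trans (NP N (leqnn N)); apply: le_trans (ler_norm _).
by rewrite lerD2r; apply: nondecreasing_cvgn_le => //; exact: eig_energy_nd.
Qed.

Lemma sqr_norm_resid v n : `|v - eig_sum (coef (iota v)) n| ^+ 2 =
  `|v| ^+ 2 - eig_energy (coef (iota v)) n.
Proof.
have [_ _ Anorm] := hA1; rewrite -!Anorm.
rewrite (formBl energy_psd) !(formBr energy_psd) (formC energy_psd v).
rewrite !energy_eig_sum Anorm opprB addrA.
have -> : \sum_(0 <= k < n) alpha k * coef (iota v) k *
    coef (iota (eig_sum (coef (iota v)) n)) k = eig_energy (coef (iota v)) n.
  rewrite /eig_energy big_nat_cond [RHS]big_nat_cond.
  by apply: eq_bigr => k /andP[/andP[_ kn] _]; rewrite coef_eig_sum kn -mulrA -expr2.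
have -> : \sum_(0 <= k < n) alpha k * coef (iota v) k * coef (iota v) k =
    eig_energy (coef (iota v)) n.
  by apply: eq_bigr => k _; rewrite -mulrA -expr2.
by rewrite addrK.
Qed.

Lemma bessel_energy v n : eig_energy (coef (iota v)) n <= `|v| ^+ 2.
Proof. by rewrite -subr_ge0 -sqr_norm_resid sqr_ge0. Qed.

(** The expansion converges in [V] to some limit by the Bessel inequality for the
    energy product, and that limit is [v] because the expansion of [iota v]
    already converges to [iota v] in [H]. *)
Lemma eig_sum_coef_cvg v : eig_sum (coef (iota v)) n @[n --> \oo] --> v.
Proof.
have [injI contI _ _] := hA2; have [_ _ _ _ comp] := he.
have cv : cvgn (eig_sum (coef (iota v))) by apply: eig_sum_cvg (bessel_energy v).
suff vE : limn (eig_sum (coef (iota v))) = v by rewrite -[X in _ --> X]vE.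
apply: injI; apply/esym; apply: (@norm_cvg_unique _ _ _ _ _ _ (comp (iota v))) => /=.
rewrite (_ : (fun n => _) = iota \o eig_sum (coef (iota v))).
  exact: continuous_cvg (contI _) cv.
by apply/funext => n; rewrite /= linear_sum; apply: eq_bigr => k _; rewrite linearZ.
Qed.

(** The partial sums are the products of [h] with those of its expansion. *)
Lemma parseval h : \sum_(0 <= k < n) coef h k ^+ 2 @[n --> \oo] --> `|h| ^+ 2.
Proof.
have [_ _ _ _ comp] := he.
apply/cvgrPdist_le => eps eps0.
have h1 : 0 < `|h| + 1 by rewrite ltr_wpDl.
have ev : 0 < eps / (`|h| + 1) by rewrite divr_gt0.
have /cvgrPdist_le /(_ _ ev) [N _ NP] := comp h.
exists N => // n /= /NP hn; rewrite H_hilbert.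
have -> : \sum_(0 <= k < n) coef h k ^+ 2 =
    dot h (\sum_(0 <= k < n) dot h (iota (e k)) *: iota (e k)).
  by rewrite (form_sumr dot_psd); apply: eq_bigr => k _; rewrite (formZr dot_psd).
rewrite -(formBr dot_psd); apply: le_trans (dot_le _ _) _.
apply: le_trans (ler_wpM2l (normr_ge0 h) hn) _.
by rewrite mulrA ler_pdivrMr// mulrC ler_wpM2l ?ltW// ltrDl.
Qed.

End Spectral.

(** * Fractional powers, oblique projections and feedback *)

Section Feedback.
Context (R : realType) (H V : completeNormedModType R).
Context (dot : {dot H for idfun}) (iota : {linear V -> H}).
Context (A : V -> V -> R^o) (alpha : nat -> R) (e : nat -> V) (rho : R).
Hypothesis H_hilbert : forall h : H, `|h| ^+ 2 = dot h h.
Hypothesis hA1 : assumption_A1 A.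
Hypothesis hA2 : assumption_A2 iota.
Hypothesis he : eigenbasis dot iota A alpha e.
Hypothesis hrho : rho <= 1.

Local Notation coefV v := (coef dot iota e (iota v)).
Let dotP := dot_psd H_hilbert.
Let energyP := energy_psd hA1.

Lemma powR_le_alpha0 k : alpha k `^ (rho - 1) <= alpha 0 `^ (rho - 1).
Proof.
have a0 j := alpha_gt0 he j.
rewrite -(opprB 1 rho) !powRN lef_pV2 ?posrE ?powR_gt0//.
have [[_ ah] _ _ _ _] := he.
by apply: ge0_ler_powR; rewrite ?nnegrE ?subr_ge0 ?ah// ltW.
Qed.

(** Since [rho <= 1], the vectors [A^(rho-1) w] stay in [V], and [A^rho w] is
    the functional [A (A^(rho-1) w)]. *)
Lemma frac_power_exists w : exists z : V,
  dnorm (A z - \sum_(0 <= k < n)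
     (alpha k `^ rho * dot (iota w) (iota (e k))) *: toV' dot iota (iota (e k)))
  @[n --> \oo] --> 0%E.
Proof.
pose c k := alpha k `^ (rho - 1) * coefV w k.
have a0 j := alpha_gt0 he j.
have [z zP] : exists z : V, eig_sum e c n @[n --> \oo] --> z.
  suff : cvgn (eig_sum e c) by move=> cv; exists (limn (eig_sum e c)).
  apply: (eig_sum_cvg H_hilbert hA1 he (M := (alpha 0 `^ (rho - 1)) ^+ 2 * `|w| ^+ 2)) => n.
  apply: le_trans (ler_wpM2l (sqr_ge0 _) (bessel_energy H_hilbert hA1 he w n)).
  rewrite /eig_energy big_distrr/=; apply: ler_sum => k _.
  rewrite /c exprMn mulrCA; apply: ler_wpM2r.
    by rewrite mulr_ge0 ?sqr_ge0 ?(ltW (a0 k)).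
  by rewrite ler_sqr ?nnegrE ?powR_ge0// powR_le_alpha0.
exists z; apply: (@squeeze_cvge _ _ _ _ (cst 0%E) _ (fun n => `|z - eig_sum e c n|%:E)).
- apply: nearW => n; rewrite dnorm_ge0/=.
  rewrite (_ : A z - _ = A (z - eig_sum e c n)).
    apply: le_dnorm => // [|v]; first by case: energyP.
    exact: energy_le.
  apply/funext => v; rewrite (formBl energyP); congr (_ - _).
  rewrite fct_sumE (energy_eig_sum H_hilbert hA1 he); apply: eq_bigr => k _.
  rewrite /c /toV' mulrA -[X in X * _ * _ * _](@powRr1 _ (alpha k)) ?(ltW (a0 k))//.
  rewrite -powRD; last by rewrite (gt_eqF (a0 k)) implybT.
  by rewrite addrCA subrr addr0 /coef (formC dotP (iota v)).
- exact: cvg_cst.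
- apply: cvg_EFin; first exact: nearW.
  have := cvg_norm (cvgB (cvg_cst z) zP); rewrite subrr normr0.
  exact.
Qed.

Local Notation Arho := (frac_power dot iota alpha e rho).

Lemma frac_power_spec w : linear (Arho w) /\ forall v,
  \sum_(0 <= k < n) alpha k `^ rho * coefV w k * coefV v k @[n --> \oo] --> Arho w v.
Proof.
pose S n : V -> R^o := \sum_(0 <= k < n)
     (alpha k `^ rho * dot (iota w) (iota (e k))) *: toV' dot iota (iota (e k)).
have SE n v : S n v = \sum_(0 <= k < n) alpha k `^ rho * coefV w k * coefV v k.
  by rewrite /S fct_sumE; apply: eq_bigr => k _; rewrite /toV' /coef (formC dotP (iota v)).
have lim f : dnorm (f - S n) @[n --> \oo] --> 0%E -> forall v, S n v @[n --> \oo] --> f v.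
  by move=> fS v; exact: dnorm_cvg_eval.
have [z zP] := frac_power_exists w.
have fP : dnorm (Arho w - S n) @[n --> \oo] --> 0%E.
  by apply: (@xgetPex _ 0 [set f | dnorm (f - S n) @[n --> \oo] --> 0%E]); exists (A z).
have -> : Arho w = A z.
  apply/funext => v; apply: (@norm_cvg_unique _ _ (S n v @[n --> \oo])) => /=.
    exact: lim.
  exact: lim.
split=> [|v]; first by case: energyP.
by rewrite (_ : (fun n => _) = (fun n => S n v)); [exact: lim|apply/funext => n; rewrite SE].
Qed.

Lemma frac_power_psd : psd_form (Arho).
Proof.
split=> [y|y z|y]; first by have [] := frac_power_spec y.
- have [_ /(_ z) yz] := frac_power_spec y; have [_ /(_ y) zy] := frac_power_spec z.
  apply: (@norm_cvg_unique _ _ _ _ _ _ yz) => /=.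
  rewrite (_ : (fun n => _) = (fun n => \sum_(0 <= k < n) alpha k `^ rho * coefV z k * coefV y k))//.
  by apply/funext => n; apply: eq_bigr => k _; rewrite mulrAC.
- have [_ /(_ y) yy] := frac_power_spec y.
  apply: (cvgr_to_ge yy); apply: nearW => n; apply: sumr_ge0 => k _.
  by rewrite -mulrA mulr_ge0 ?powR_ge0// -expr2 sqr_ge0.
Qed.

(** All the terms of the series of [A^rho w] at [w] are nonnegative, so they vanish
    together with its sum. *)
Lemma frac_power_pos w : Arho w w = 0 -> w = 0.
Proof.
move=> w0; have [_ /(_ w)] := frac_power_spec w; rewrite w0.
set S := (fun n => _) => S0.
have nd : nondecreasing_seq S.
  apply/nondecreasing_seqP => n; rewrite /S big_nat_recr//= lerDl.
  by rewrite -mulrA mulr_ge0 ?powR_ge0// -expr2 sqr_ge0.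
have Sle n : S n <= 0.
  have := nondecreasing_cvgn_le nd (cvgP _ S0) n.
  by rewrite (cvg_lim (@Rhausdorff R) S0).
have cw k : coefV w k = 0.
  apply/eqP; rewrite -sqrf_eq0; apply/eqP/le_anti; rewrite sqr_ge0 andbT.
  rewrite -(pmulr_rle0 _ (powR_gt0 rho (alpha_gt0 he k))).
  have := Sle k.+1; rewrite /S big_nat_recr//= -mulrA -expr2.
  apply: le_trans; rewrite lerDr; apply: sumr_ge0 => j _.
  by rewrite -mulrA mulr_ge0 ?powR_ge0// -expr2 sqr_ge0.
have [inj _ _ _] := hA2; apply: inj; rewrite linear0.
apply/eqP; rewrite -normr_eq0 -sqrf_eq0; apply/eqP.
rewrite -(cvg_lim (@Rhausdorff R) (parseval H_hilbert he (h := iota w))).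
apply: cvg_lim; first exact: Rhausdorff.
rewrite (_ : (fun n => _) = cst 0); first exact: cvg_cst.
by apply/funext => n; rewrite big1// => k _; rewrite cw expr0n.
Qed.

Section Projections.
Context (m : nat) (U : set H) (W : set V).
Hypothesis dimU : has_dim U m.
Hypothesis dimW : has_dim W m.
Hypothesis sumUW : direct_sum U (perp dot (iota @` W)).

Lemma perp_lspan (b : 'I_m -> H) h :
  (forall i, dot h (b i) = 0) -> perp dot (lspan b) h.
Proof.
move=> hb _ [c ->]; rewrite (form_sumr dotP) big1// => i _.
by rewrite (formZr dotP) hb mulr0.
Qed.

(** A combination of the actuators orthogonal to [W] lies in [U] and in the
    orthogonal of [W], whose intersection is trivial. Invertibility of this
    mixed Gram matrix gives both oblique projections. *)
Lemma mixed_gram (b : 'I_m -> H) (w : 'I_m -> V) :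
  lin_indep b -> U = lspan b -> W = lspan w ->
  forall c : 'I_m -> R,
  (forall j, \sum_(i < m) c i * dot (b i) (iota (w j)) = 0) -> forall i, c i = 0.
Proof.
move=> bi Ub Ww c cG; apply: bi.
have [_ UW0] := sumUW.
suff : [set 0] (\sum_(i < m) c i *: b i) by [].
rewrite -UW0; split; first by rewrite Ub; exists c.
move=> _ [x Wx <-]; move: Wx; rewrite Ww => -[d ->].
rewrite linear_sum (form_sumr dotP) big1// => j _.
rewrite linearZ (formZr dotP) (form_suml dotP).
under eq_bigr do rewrite (formZl dotP).
by rewrite cG mulr0.
Qed.

Lemma aux_projP h : W (aux_proj dot iota U W h) /\
  perp dot U (h - iota (aux_proj dot iota U W h)).
Proof.
have [b [bi Ub]] := dimU; have [w [wi Ww]] := dimW.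
have [_ inj] := injective_system (mixed_gram bi Ub Ww).
have [|solve _] := @injective_system R m (fun j i => dot (b i) (iota (w j))).
  move=> c cG; apply: inj => i; rewrite -[RHS](cG i).
  by apply: eq_bigr => j _; rewrite mulrC.
have [c cP] := solve (fun i => dot h (b i)).
pose q := lincomb w c.
have Wq : W q by rewrite Ww; exists c.
have qP : perp dot U (h - iota q).
  rewrite Ub; apply: perp_lspan => i; rewrite (formBl dotP) -cP.
  rewrite /q /lincomb linear_sum (form_suml dotP); apply/eqP; rewrite subr_eq0.
  apply/eqP; apply: eq_bigr => j _.
  by rewrite linearZ (formZl dotP) (formC dotP (iota _)).
have [[q' Wq' q'E] oP] : (iota @` W) (oblique_proj (iota @` W) (perp dot U) h) /\
    perp dot U (h - oblique_proj (iota @` W) (perp dot U) h).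
  apply: (@xgetPex _ 0 [set f | (iota @` W) f /\ perp dot U (h - f)]).
  by exists (iota q); split=> //; exists q.
have [Wa aE] : W (aux_proj dot iota U W h) /\ iota (aux_proj dot iota U W h) =
    oblique_proj (iota @` W) (perp dot U) h.
  apply: (@xgetPex _ 0 [set w | W w /\ iota w = oblique_proj (iota @` W) (perp dot U) h]).
  by exists q'.
by split=> //; rewrite aE.
Qed.

Lemma orth_projP h : U (orth_proj dot U h) /\ perp dot U (h - orth_proj dot U h).
Proof.
have [b [bi Ub]] := dimU.
apply: (@xgetPex _ 0 [set f | U f /\ perp dot U (h - f)]).
have [|solve _] := @injective_system R m (fun j i => dot (b j) (b i)).
  move=> c cG; apply: bi; apply/eqP; rewrite -normr_eq0 -sqrf_eq0 H_hilbert.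
  rewrite (form_sumr dotP) big1// => j _; rewrite (formZr dotP) (form_suml dotP).
  under eq_bigr do rewrite (formZl dotP).
  by rewrite cG mulr0.
have [c cP] := solve (fun i => dot h (b i)).
exists (lincomb b c); split; first by rewrite Ub; exists c.
rewrite Ub; apply: perp_lspan => i; rewrite (formBl dotP) -cP.
rewrite /lincomb (form_suml dotP); apply/eqP; rewrite subr_eq0.
by apply/eqP; apply: eq_bigr => j _; rewrite (formZl dotP).
Qed.

(** The functional [f] composed with the auxiliary projection only sees the
    products of its argument with the basis of [U], so an element of [U]
    represents it. *)
Lemma ext_projP (f : V -> R^o) (phi : V) : linear f ->
  dot (ext_proj dot iota U W f) (iota phi) = f (aux_proj dot iota U W (iota phi)).
Proof.
move=> lf.
have fD x y a : f (a *: x + y) = a * f x + f y by rewrite lf.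
have f0 : f 0 = 0 by have := fD 0 0 1; rewrite scale1r addr0 mul1r; lra.
have fsum c (w : 'I_m -> V) : f (lincomb w c) = \sum_j c j * f (w j).
  by rewrite /lincomb; elim/big_rec2: _ => // j y x _ <-; rewrite fD.
have [b [bi Ub]] := dimU; have [w [wi Ww]] := dimW.
have [solve _] := injective_system (mixed_gram bi Ub Ww).
have [d dP] := solve (fun j => f (w j)).
suff [_ eP] : U (ext_proj dot iota U W f) /\ forall phi : V,
    toV' dot iota (ext_proj dot iota U W f) phi = f (aux_proj dot iota U W (iota phi)).
  exact: eP.
apply: (@xgetPex _ 0 [set u | U u /\
    forall phi : V, toV' dot iota u phi = f (aux_proj dot iota U W (iota phi))]).
exists (lincomb b d); split=> [|v]; first by rewrite Ub; exists d.
have [] := aux_projP (iota v); set q := aux_proj _ _ _ _ _.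
rewrite {1}Ww => -[c qc] qP; rewrite qc (fsum c w) /toV' /lincomb (form_suml dotP).
transitivity (\sum_i d i * dot (b i) (iota q)).
  apply: eq_bigr => i _; rewrite (formZl dotP); congr (_ * _).
  apply/eqP; rewrite -subr_eq0 -(formBr dotP) (formC dotP) qP//.
  rewrite Ub; exists (fun j => (i == j)%:R); rewrite (bigD1 i)//= eqxx scale1r.
  by rewrite big1 ?addr0// => j ji; rewrite eq_sym (negbTE ji) scale0r.
under eq_bigr do rewrite qc linear_sum (form_sumr dotP) big_distrr/=.
rewrite exchange_big/=; apply: eq_bigr => j _; rewrite -dP big_distrr/=.
by apply: eq_bigr => i _; rewrite linearZ (formZr dotP) mulrCA.
Qed.

Lemma lincomb_norm_le (w : 'I_m -> V) (c : 'I_m -> R) (X : R) :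
  (forall j, c j ^+ 2 <= X) ->
  `|lincomb w c| ^+ 2 <= X * (\sum_j `|w j|) ^+ 2.
Proof.
move=> cX; pose s := \sum_j `|w j|; have s0 : 0 <= s by apply: sumr_ge0.
have nX : `|lincomb w c| <= Num.sqrt X * s.
  apply: le_trans (ler_norm_sum _ _ _) _; rewrite /s big_distrr/=.
  apply: ler_sum => j _; rewrite normrZ ler_wpM2r//.
  by rewrite -sqrtr_sqr ler_wsqrtr.
have [X0|X0] := leP 0 X.
  rewrite -[X in X * _](sqr_sqrtr X0) -exprMn ler_sqr ?nnegrE ?mulr_ge0//.
rewrite [lincomb _ _](_ : _ = 0) ?normr0 ?expr0n/=; last first.
  by apply/eqP; rewrite -normr_le0 (le_trans nX)// ler0_sqrtr ?mul0r// ltW.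
rewrite /s big1 ?expr0n ?mulr0// => j.
by have := le_lt_trans (le_trans (sqr_ge0 _) (cX j)) X0; rewrite ltxx.
Qed.

Lemma feedback_orthE v : feedback_orth dot iota U (iota v) v =
  `|orth_proj dot U (iota v)| ^+ 2.
Proof.
have [Up Pp] := orth_projP (iota v); rewrite /feedback_orth /toV' H_hilbert.
apply/eqP; rewrite -subr_eq0 -(formBr dotP) (formC dotP); apply/eqP; exact: Pp.
Qed.

Lemma feedback_obliqueE v : let q := aux_proj dot iota U W (iota v) in
  feedback_oblique dot iota alpha e rho U W (iota v) v = Arho q q.
Proof.
by rewrite /feedback_oblique /toV' /= ext_projP//; have [] := frac_power_spec
  (aux_proj dot iota U W (iota v)).
Qed.

(** With [q] the auxiliary component of the state, the oblique feedback pairs with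
    it to [A^rho q] at [q], a form that dominates every norm on the
    finite-dimensional [W]; the orthogonal one controls the coordinates of [q],
    which are products of fixed vectors with the projection on [U]. *)
Lemma feedback_coercive : exists2 kappa : R, 0 < kappa & forall v : V,
  exists q : V, [/\ perp dot U (iota (v - q)),
    kappa * `|q| ^+ 2 <= feedback_orth dot iota U (iota v) v &
    kappa * `|q| ^+ 2 <= feedback_oblique dot iota alpha e rho U W (iota v) v].
Proof.
have [b [bi Ub]] := dimU; have [w [wi Ww]] := dimW.
have [solve _] := injective_system (mixed_gram bi Ub Ww).
(* [D] is the family in [U] dual to [w]; it reads off the coordinates *)
have [d dP] := choice (fun j => solve (fun k => (j == k)%:R)).
pose D j := lincomb b (d j).
pose K1 := \sum_j `|D j| ^+ 2.
have K10 : 0 <= K1 by apply: sumr_ge0 => j _; rewrite sqr_ge0.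
have [|K2 K20 K2P] := @form_dominates_coords _ _ _ frac_power_psd _ w.
  by move=> c /frac_power_pos; exact: wi.
pose L := (\sum_j `|w j|) ^+ 2; have L0 : 0 <= L by rewrite sqr_ge0.
pose K := K1 * L + K2 * L + 1.
have K0 : 0 < K by rewrite ltr_wpDl// addr_ge0// mulr_ge0.
exists K^-1 => [|v]; first by rewrite invr_gt0.
exists (aux_proj dot iota U W (iota v)).
have [Wq Pq] := aux_projP (iota v); rewrite feedback_obliqueE feedback_orthE.
set q := aux_proj dot iota U W (iota v) in Wq Pq *.
have : W q by []; rewrite {1}Ww => -[c qc].
split.
- by rewrite linearB.
- have [Up Pp] := orth_projP (iota v); set p := orth_proj _ _ _ in Up Pp *.
  have cE j : c j = dot p (D j).
    have UD : U (D j) by rewrite Ub; exists (d j).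
    have -> : dot p (D j) = dot (iota q) (D j).
      apply/eqP; rewrite -subr_eq0 -(formBl dotP); apply/eqP.
      rewrite (_ : p - iota q = (iota v - iota q) - (iota v - p)); last first.
        by rewrite opprB [RHS]addrC addrA subrK.
      by rewrite (formBl dotP) (Pq _ UD) (Pp _ UD) subrr.
    rewrite qc (linear_sum iota) (form_suml dotP) (bigD1 j)//= big1 => [|k kj];
      rewrite linearZ (formZl dotP) /D /lincomb (form_sumr dotP);
      under eq_bigr do rewrite (formZr dotP) (formC dotP); rewrite dP.
      by rewrite eqxx mulr1 addr0.
    by rewrite eq_sym (negbTE kj) mulr0.
  rewrite ler_pdivrMl//.
  have := @lincomb_norm_le w c (`|p| ^+ 2 * K1).
  rewrite {1}/lincomb -qc => /(_ _)/le_trans; apply.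
    move=> j; rewrite cE; apply: le_trans (form_CS dotP _ _) _.
    rewrite -!H_hilbert ler_wpM2l ?sqr_ge0//.
    by rewrite /K1 (bigD1 j)//= lerDl; apply: sumr_ge0 => k _; rewrite sqr_ge0.
  rewrite -mulrA mulrC ler_wpM2r ?sqr_ge0// /K -/L.
  by rewrite -addrA lerDl addr_ge0// mulr_ge0.
- rewrite ler_pdivrMl//.
  have S0 := form_ge0 frac_power_psd q.
  have := @lincomb_norm_le w c (K2 * Arho q q).
  rewrite {1}/lincomb -qc => /(_ _)/le_trans; apply.
    move=> j; have := K2P c; rewrite /lincomb -qc; apply: le_trans.
    by rewrite (bigD1 j)//= lerDl; apply: sumr_ge0 => k _; rewrite sqr_ge0.
  rewrite mulrAC ler_wpM2r// /K -/L -addrA.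
  by rewrite [leRHS]addrCA lerDl addr_ge0// mulr_ge0.
Qed.

End Projections.

End Feedback.

(** * Coercivity: spectral gap, reaction and nonlinearity *)

Section Coercivity.
Context (R : realType) (H V : completeNormedModType R).
Context (dot : {dot H for idfun}) (iota : {linear V -> H}).
Context (A : V -> V -> R^o) (alpha : nat -> R) (e : nat -> V).
Hypothesis H_hilbert : forall h : H, `|h| ^+ 2 = dot h h.
Hypothesis hA1 : assumption_A1 A.
Hypothesis hA2 : assumption_A2 iota.
Hypothesis he : eigenbasis dot iota A alpha e.
Let dotP := dot_psd H_hilbert.

Lemma poincare v : alpha 0 * `|iota v| ^+ 2 <= `|v| ^+ 2.
Proof.
have a0 := alpha_gt0 he 0.
rewrite mulrC -ler_pdivlMr//.
apply: (cvgr_to_le (parseval H_hilbert he (h := iota v))); apply: nearW => n.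
rewrite ler_pdivlMr// mulrC; apply: le_trans (bessel_energy H_hilbert hA1 he v n).
rewrite big_distrr/=; apply: ler_sum => k _; rewrite ler_wpM2r ?sqr_ge0//.
by have [[_ ah] _ _ _ _] := he; exact: ah.
Qed.

(** Splitting the state into [q] and a component orthogonal to the actuators:
    the spectral gap [xi] absorbs the latter, the feedback the former. *)
Lemma gap_estimate (U : set H) (xi D kappa lambda F : R) (v q : V) :
  0 < xi -> 0 <= D -> 8 * D <= xi -> 0 < kappa ->
  (forall w, perp dot U (iota w) -> xi * `|iota w| ^+ 2 <= `|w| ^+ 2) ->
  perp dot U (iota (v - q)) ->
  kappa * `|q| ^+ 2 <= F -> (1 + 2 * D / alpha 0) / kappa <= lambda ->
  D * `|iota v| ^+ 2 <= `|v| ^+ 2 / 2 + lambda * F.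
Proof.
move=> xi0 D0 Dxi k0 gap /gap Qgap qF lam.
have a0 := alpha_gt0 he 0.
have split2 (X : completeNormedModType R) (x y : X) : `|x + y| ^+ 2 <= 2 * `|x| ^+ 2 + 2 * `|y| ^+ 2.
  have n0 := normr_ge0 (x + y); have := ler_normD x y.
  have := sqr_ge0 (`|x| - `|y|); nra.
have hv : `|iota v| ^+ 2 <= 2 * `|iota (v - q)| ^+ 2 + 2 * `|iota q| ^+ 2.
  by rewrite -[X in iota X](subrK q v) linearD; exact: split2.
have vq : `|v - q| ^+ 2 <= 2 * `|v| ^+ 2 + 2 * `|q| ^+ 2.
  by have := split2 V v (- q); rewrite normrN.
have pq := poincare q.
have lamF : (1 + 2 * D / alpha 0) * `|q| ^+ 2 <= lambda * F.
  rewrite ler_pdivrMr// in lam.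
  have q0 := sqr_ge0 `|q|.
  have l0 : 0 <= lambda.
    rewrite -(pmulr_lge0 _ k0); apply: le_trans lam.
    by rewrite addr_ge0// !mulr_ge0// invr_ge0 ltW.
  apply: le_trans (ler_wpM2l l0 qF); rewrite [leRHS]mulrA.
  exact: ler_wpM2r.
have Dq : D * `|iota q| ^+ 2 <= D / alpha 0 * `|q| ^+ 2.
  by rewrite -mulrA ler_wpM2l// ler_pdivlMl.
have DQ : 8 * (D * `|iota (v - q)| ^+ 2) <= `|v - q| ^+ 2.
  by apply: le_trans Qgap; rewrite mulrA ler_wpM2r ?sqr_ge0.
have Dv : D * `|iota v| ^+ 2 <= D * (2 * `|iota (v - q)| ^+ 2 + 2 * `|iota q| ^+ 2).
  exact: ler_wpM2l.
apply: le_trans Dv _; apply: le_trans _ (lerD (lexx _) lamF).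
move: Dq DQ vq; set x := `|iota (v - q)| ^+ 2; set y := `|iota q| ^+ 2.
rewrite -(mulrA 2 D); move: (D / alpha 0) (sqr_ge0 `|q|) => d *; lra.
Qed.

(** The shifts by 1 and 2 leave room for a decomposition and for operator bounds
    that only approach their infima. *)
Lemma reaction_bound (B : V -> V -> R^o) (C : R) (v : V) :
  (sum_norm dot iota B <= C%:E)%E ->
  `|B v v| <= `|v| ^+ 2 / 4 + 4 * (C + 2) ^+ 2 * `|iota v| ^+ 2.
Proof.
move=> BC.
have : (sum_norm dot iota B < (C + 1)%:E)%E.
  by apply: le_lt_trans BC _; rewrite lte_fin ltrDl.
move=> /ereal_inf_lt[_ [B1 [B2 [f1 f2 BE ->]]]]; rewrite lte_fin => sqC.
have op_ge0 (X : normedModType R) (Y : lmodType R) (nY : Y -> \bar R) (T : X -> Y) :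
    (0 <= opnorm nY T)%E.
  by apply: le_ereal_inf_tmp => _ [c [c0 _ _] <-]; rewrite lee_fin.
have below (X : normedModType R) (Y : lmodType R) (nY : Y -> \bar R) (T : X -> Y) :
    (opnorm nY T < +oo)%E -> fine (opnorm nY T) < C + 1 ->
    exists c : R, [/\ 0 <= c, c <= C + 2 & forall x, (nY (T x) <= (c * `|x|)%:E)%E].
  move=> fT TC; have : (opnorm nY T < (C + 1)%:E)%E.
    rewrite -(@fineK _ (opnorm nY T)) ?lte_fin// ge0_fin_numE//.
  by move=> /opnorm_bound[c [c0 cC _ Tc]]; exists c; rewrite lte_fin in cC; split=> //; lra.
have [c1 [c10 c1C B1c]] : exists c : R, [/\ 0 <= c, c <= C + 2 &
    forall x, (dnorm (B1 x) <= (c * `|x|)%:E)%E].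
  apply: below => //; apply: le_lt_trans sqC.
  rewrite -[X in X <= _]ger0_norm ?fine_ge0// -sqrtr_sqr ler_wsqrtr//.
  by rewrite lerDl sqr_ge0.
have [c2 [c20 c2C B2c]] : exists c : R, [/\ 0 <= c, c <= C + 2 &
    forall x, (enorm (B2 x) <= (c * `|x|)%:E)%E].
  apply: below => //; apply: le_lt_trans sqC.
  rewrite -[X in X <= _]ger0_norm ?fine_ge0// -sqrtr_sqr ler_wsqrtr//.
  by rewrite lerDr sqr_ge0.
have b1 : `|B1 (iota v) v| <= (C + 2) * `|iota v| * `|v|.
  apply: le_trans (dnorm_le _ (B1c _)) _.
  by rewrite -!mulrA ler_wpM2r// mulr_ge0.
have b2 : `|toV' dot iota (B2 v) v| <= (C + 2) * `|iota v| * `|v|.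
  apply: le_trans (dot_le H_hilbert _ _) _.
  have := B2c v; rewrite /enorm lee_fin => B2v.
  rewrite mulrAC ler_wpM2r//; apply: le_trans B2v _; exact: ler_wpM2r.
rewrite BE; apply: le_trans (ler_normD _ _) _; apply: le_trans (lerD b1 b2) _.
have := sqr_ge0 (`|v| / 2 - 2 * (C + 2) * `|iota v|); nra.
Qed.

Lemma pos_powRD (x a b : R) : 0 < x -> x `^ (a + b) = x `^ a * x `^ b.
Proof. by move=> x0; rewrite powRD// (gt_eqF x0) implybT. Qed.

(** Either the first term on the right dominates, or [v ^ (1 - b)] is at most
    [g h ^ a]; in the latter case the left side is bounded by a power of [h]
    alone, of exponent [2 a / (1 - b)], which is at least 2. *)
Lemma young_powR (a b g r h v : R) : 0 <= b -> b < 1 -> 1 <= a + b -> 0 < g ->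
  0 < h -> h <= r -> 0 < v ->
  h `^ a * v `^ (1 + b) <= g^-1 * v ^+ 2
    + g `^ ((1 + b) / (1 - b)) * r `^ (2 * a / (1 - b) - 2) * h ^+ 2.
Proof.
move=> b0 b1 ab g0 h0 hr v0.
have b1' : 0 < 1 - b by lra.
have r0 : 0 < r by lra.
have [small|big] := leP (h `^ a * v `^ (1 + b)) (g^-1 * v ^+ 2).
  by apply: le_trans small _; rewrite lerDl !mulr_ge0 ?powR_ge0// ltW.
have v2 : v ^+ 2 = v `^ (1 - b) * v `^ (1 + b).
  by rewrite -pos_powRD// -powR_mulrn ?(ltW v0)//; congr (_ `^ _); ring.
have lt1 : v `^ (1 - b) <= g * h `^ a.
  rewrite v2 mulrA ltr_pM2r ?powR_gt0// ltr_pdivrMl// in big.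
  exact: ltW.
have p0 : 0 <= (1 + b) / (1 - b) by rewrite divr_ge0; lra.
have vb : v `^ (1 + b) <= g `^ ((1 + b) / (1 - b)) * h `^ (a * ((1 + b) / (1 - b))).
  rewrite (powRrM h) -powRM ?powR_ge0 ?(ltW g0)//.
  have -> : v `^ (1 + b) = (v `^ (1 - b)) `^ ((1 + b) / (1 - b)).
    by rewrite -powRrM mulrCA divff ?mulr1// gt_eqF.
  by apply: ge0_ler_powR => //; rewrite nnegrE ?powR_ge0// mulr_ge0 ?powR_ge0 ?(ltW g0).
apply: ler_wpDl; first by rewrite mulr_ge0 ?sqr_ge0// invr_ge0 ltW.
apply: le_trans (ler_wpM2l (powR_ge0 _ _) vb) _.
rewrite mulrCA -[leRHS]mulrA ler_wpM2l ?powR_ge0//.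
rewrite -pos_powRD//.
have -> : a + a * ((1 + b) / (1 - b)) = (2 * a / (1 - b) - 2) + 2.
  by field; rewrite gt_eqF.
rewrite pos_powRD// powR_mulrn ?(ltW h0)// ler_wpM2r ?sqr_ge0//.
apply: ge0_ler_powR; rewrite ?nnegrE ?(ltW h0) ?(ltW r0)//.
by rewrite subr_ge0 ler_pdivlMr//; lra.
Qed.

Context (n : nat) (zeta1 zeta2 delta1 delta2 : 'I_n -> R).
Hypothesis hA4 : A4_exponents zeta1 zeta2 delta1 delta2.

(** The factor [8 n (CN + 1)] makes the contributions of the [n] terms to the
    square of the norm of [V] sum up to at most one quarter; the leading 2
    bounds the two summands of the growth condition at the pair [(v, 0)]. *)
Definition nonlin_weight (r CN : R) : R :=
  2 * CN * \sum_(j < n) (8 * n%:R * (CN + 1)) `^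
      ((1 + (zeta2 j + delta2 j)) / (1 - (zeta2 j + delta2 j)))
    * r `^ (2 * (zeta1 j + delta1 j) / (1 - (zeta2 j + delta2 j)) - 2).

Lemma nonlin_bound (N : R -> V -> V -> R^o) (CN t r : R) (v : V) :
  assumption_A4 iota zeta1 zeta2 delta1 delta2 N CN -> 0 < t ->
  Cb_iota (N t) -> `|iota v| <= r ->
  `|N t v v| <= `|v| ^+ 2 / 4 + nonlin_weight r CN * `|iota v| ^+ 2.
Proof.
move=> [_ CN0 lip _] t0 [_ _ [i [_ _ i0 Ni]]] vr.
have [n0 exps] := hA4.
(* the modulus of [N t] vanishes at 0 *)
have N0 : N t 0 = 0.
  apply/funext => w; apply/eqP; rewrite -normr_le0.
  have := @dnorm_le _ _ (N t 0) 0 w; rewrite mul0r; apply.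
  by have := Ni 0; rewrite normr0 i0.
have [->|vn0] := eqVneq v 0.
  by rewrite (_ : N t 0 0 = 0) ?N0// linear0 !normr0 expr0n/= mul0r mulr0 addr0.
have [injI _ _ _] := hA2.
have v0 : 0 < `|v| by rewrite normr_gt0.
have h0 : 0 < `|iota v|.
  by rewrite normr_gt0; apply: contra vn0 => /eqP hv; apply/eqP/injI; rewrite hv linear0.
have := lip t t0 v 0; rewrite N0 !subr0 linear0 !normr0 => /(@dnorm_le _ _ _ _ v) Nv.
apply: le_trans Nv _; set h := `|iota v| in h0 vr *; set w := `|v| in v0 *.
pose g : R := 8 * n%:R * (CN + 1).
have n1 : (1 : R) <= n%:R by rewrite ler1n.
have g0 : 0 < g by rewrite !mulr_gt0 ?ltr0n//; lra.
pose p j := (1 + (zeta2 j + delta2 j)) / (1 - (zeta2 j + delta2 j)).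
pose q j := 2 * (zeta1 j + delta1 j) / (1 - (zeta2 j + delta2 j)) - 2.
have term j : (h `^ zeta1 j * w `^ zeta2 j + 0 `^ zeta1 j * 0 `^ zeta2 j)
    * h `^ delta1 j * w `^ delta2 j * w <=
    2 * (g^-1 * w ^+ 2 + g `^ p j * r `^ q j * h ^+ 2).
  have [[z1 z2 d1 d2] zd dd] := exps j.
  have mono x y : 0 < (x : R) -> 0 <= y -> 0 `^ y <= x `^ y.
    by move=> x0 y0; apply: ge0_ler_powR; rewrite ?nnegrE ?(ltW x0).
  (* not 0 in general, since [0 `^ 0 = 1] *)
  have zz : 0 `^ zeta1 j * 0 `^ zeta2 j <= h `^ zeta1 j * w `^ zeta2 j.
    by apply: ler_pM; rewrite ?powR_ge0 ?mono.
  have := @young_powR (zeta1 j + delta1 j) (zeta2 j + delta2 j) g r h w.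
  move=> /(_ _ zd _ g0 h0 vr v0) => Y.
  apply: le_trans (ler_wpM2l _ (Y _ _)); rewrite ?addr_ge0//; last by lra.
  have -> : 2 * (h `^ (zeta1 j + delta1 j) * w `^ (1 + (zeta2 j + delta2 j))) =
     (h `^ zeta1 j * w `^ zeta2 j + h `^ zeta1 j * w `^ zeta2 j)
      * h `^ delta1 j * w `^ delta2 j * w.
    rewrite !pos_powRD// powRr1 ?(ltW v0)//; ring.
  rewrite !ler_wpM2r ?powR_ge0 ?(ltW v0)// lerD2l; exact: zz.
rewrite -mulrA mulr_suml; apply: le_trans (ler_wpM2l CN0 (ler_sum _ (fun j _ => term j))) _.
rewrite -big_distrr/= big_split/= sumr_const card_ord -big_distrl/= -/(nonlin_weight _ _).
rewrite mulrA [CN * 2]mulrC mulrDr; apply: lerD; last first.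
  by rewrite /nonlin_weight mulrA.
have -> : 2 * CN * (g^-1 * w ^+ 2 *+ n) = 2 * CN * n%:R / g * w ^+ 2.
  by rewrite -(mulr_natr _ n); ring.
rewrite [leRHS]mulrC ler_wpM2r ?sqr_ge0//.
rewrite /g ler_pdivrMr//; lra.
Qed.

End Coercivity.

(** * Summation of the energy identity over the eigenvectors *)

Section SeriesIdentity.
Context (R : realType).
Local Notation mu := (@lebesgue_measure R).
Context (a : nat -> R) (u g : nat -> R -> R).
Hypothesis a0 : forall k, 0 < a k.
Hypothesis cu : forall k, continuous (u k).
Hypothesis mg : forall k, measurable_fun setT (g k).

(** For the coefficients of a state and of a functional these series are the
    squares of its norms in [V] and in the dual of [V]. Unlike those norms they
    are Borel functions of time by construction. *)
Definition primal_density (x : R) : \bar R := (\sum_(0 <= k <oo) (a k * u k x ^+ 2)%:E)%E.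
Definition dual_density (x : R) : \bar R := (\sum_(0 <= k <oo) (g k x ^+ 2 / a k)%:E)%E.

Lemma primal_term_ge0 k x : (0 <= (a k * u k x ^+ 2)%:E)%E.
Proof. by rewrite lee_fin mulr_ge0 ?sqr_ge0 ?(ltW (a0 k)). Qed.

Lemma dual_term_ge0 k x : (0 <= (g k x ^+ 2 / a k)%:E)%E.
Proof. by rewrite lee_fin mulr_ge0 ?sqr_ge0 ?invr_ge0 ?(ltW (a0 k)). Qed.

Lemma primal_density_ge0 x : (0 <= primal_density x)%E.
Proof. by apply: nneseries_ge0 => k _ _; exact: primal_term_ge0. Qed.

Lemma dual_density_ge0 x : (0 <= dual_density x)%E.
Proof. by apply: nneseries_ge0 => k _ _; exact: dual_term_ge0. Qed.

Lemma measurable_primal_density D : measurable_fun D primal_density.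
Proof.
apply: measurable_funTS.
apply: (@ge0_emeasurable_sum _ _ _ setT (fun k x => (a k * u k x ^+ 2)%:E) predT).
  by move=> k x _ _; exact: primal_term_ge0.
move=> k _; apply/measurable_EFinP; apply: measurable_funM => //.
by apply: measurable_funX; apply: continuous_measurable_fun; exact: cu.
Qed.

Lemma measurable_dual_density D : measurable_fun D dual_density.
Proof.
apply: measurable_funTS.
apply: (@ge0_emeasurable_sum _ _ _ setT (fun k x => (g k x ^+ 2 / a k)%:E) predT).
  by move=> k x _ _; exact: dual_term_ge0.
move=> k _; apply/measurable_EFinP; apply: measurable_funM => //.
by apply: measurable_funX; exact: mg.
Qed.

Lemma integrable_primal_density (D : set R) : measurable D ->
  (\int[mu]_(x in D) primal_density x < +oo)%E -> mu.-integrable D primal_density.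
Proof.
move=> mD fin; apply/integrableP; split; first exact: measurable_primal_density.
by under eq_integral do rewrite (gee0_abs (primal_density_ge0 _)).
Qed.

Lemma integrable_dual_density (D : set R) : measurable D ->
  (\int[mu]_(x in D) dual_density x < +oo)%E -> mu.-integrable D dual_density.
Proof.
move=> mD fin; apply/integrableP; split; first exact: measurable_dual_density.
by under eq_integral do rewrite (gee0_abs (dual_density_ge0 _)).
Qed.

(** A function on a bounded interval is dominated by 1 plus its square. *)
Lemma integrable_dual_coef (b c : R) k :
  (\int[mu]_(x in `[b, c]) dual_density x < +oo)%E ->
  mu.-integrable `[b, c] (EFin \o g k).
Proof.
move=> fin; have mD : measurable (`[b, c]%classic : set R) by exact: measurable_itv.
have i1 : mu.-integrable `[b, c] (EFin \o cst (1 : R)).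
  by apply: continuous_integrable; exact: continuous_constf.
have i2 : mu.-integrable `[b, c] (fun x => (a k)%:E * dual_density x)%E.
  by apply: integrableZl => //; exact: integrable_dual_density.
have i12 : mu.-integrable `[b, c] (fun x => (1%:E + (a k)%:E * dual_density x)%E).
  by apply: (integrableD _ i1 i2).
apply: le_integrable i12 => //.
  by apply/measurable_EFinP; apply: measurable_funTS; exact: mg.
move=> x _; rewrite [leRHS]gee0_abs; last first.
  by rewrite adde_ge0 ?lee_fin// mule_ge0 ?dual_density_ge0// lee_fin ltW.
apply: le_trans (_ : ((1 : R)%:E + (a k)%:E * (g k x ^+ 2 / a k)%:E <= _)%E).
  rewrite -EFinM -EFinD lee_fin mulrC divfK ?gt_eqF//.
  have := real_normK (num_real (g k x)) => <-; have := normr_ge0 (g k x); nra.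
rewrite leeD2l// lee_pmul2l//= ?lte_fin//.
have := nneseries_lim_ge (P := predT) (m := 0) k.+1
  (fun n _ _ => dual_term_ge0 n x).
rewrite big_nat_recr//=; apply: le_trans; rewrite leeDr//.
by apply: sume_ge0 => j _; exact: dual_term_ge0.
Qed.

(** Summing [u_k(t)^2 - u_k(s)^2 = 2 int u_k g_k] over [k]; the partial sums of
    the integrands are dominated by the primal and dual densities. *)
Lemma sum_sqr_increment (f : R -> R) (s t Es Et : R) : s <= t ->
  (\int[mu]_(x in `[s, t]) primal_density x < +oo)%E ->
  (\int[mu]_(x in `[s, t]) dual_density x < +oo)%E ->
  (forall k b c, s <= b -> b <= c -> c <= t ->
     u k c - u k b = \int[mu]_(x in `[b, c]) g k x) ->
  (forall x, s <= x <= t -> \sum_(0 <= k < n) u k x * g k x @[n --> \oo] --> f x) ->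
  \sum_(0 <= k < n) u k s ^+ 2 @[n --> \oo] --> Es ->
  \sum_(0 <= k < n) u k t ^+ 2 @[n --> \oo] --> Et ->
  mu.-integrable `[s, t] (EFin \o f) /\
  Et - Es = 2 * \int[mu]_(x in `[s, t]) f x.
Proof.
move=> st finP finD incr fP EsP EtP.
have mD : measurable (`[s, t]%classic : set R) by exact: measurable_itv.
have ig k := integrable_dual_coef k finD.
have sqr k := sqr_increment st (@cu k) (ig k) (incr k).
pose fn n x := \sum_(0 <= k < n) u k x * g k x.
have fnP n : mu.-integrable `[s, t] (EFin \o fn n) /\
    \sum_(0 <= k < n) u k t ^+ 2 - \sum_(0 <= k < n) u k s ^+ 2 =
    2 * \int[mu]_(x in `[s, t]) fn n x.
  elim: n => [|n [in_ IH]].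
    rewrite (_ : fn 0 = cst 0); last by apply/funext => x; rewrite /fn big_geq.
    split; first by apply: continuous_integrable; exact: continuous_constf.
    by rewrite !big_geq// subrr Rintegral_cst// mul0r mulr0.
  have [iu ue] := sqr n.
  have fS : fn n.+1 = (fun x => fn n x + u n x * g n x).
    by apply/funext => x; rewrite /fn big_nat_recr.
  rewrite fS; split.
    rewrite (_ : _ \o _ = (fun x => (fn n x)%:E + (u n x * g n x)%R%:E)%E)//.
    exact: integrableD.
  rewrite !big_nat_recr//= RintegralD// mulrDr -IH -ue; ring.
have idens : mu.-integrable `[s, t] (fun x => primal_density x + dual_density x)%E.
  apply: integrableD => //; [exact: integrable_primal_density|exact: integrable_dual_density].
have mf : measurable_fun `[s, t] (EFin \o f).
  apply: (@emeasurable_fun_cvg _ _ _ _ (fun n x => (fn n x)%:E)).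
    by move=> n; have [/measurable_int] := fnP n.
  move=> x; rewrite /= in_itv/= => /fP fx.
  by apply: cvg_EFin; [exact: nearW|exact: fx].
have dom n x : (`|(fn n x)%:E| <= primal_density x + dual_density x)%E.
  apply: (@le_trans _ _ (\sum_(0 <= k < n) (a k * u k x ^+ 2)%:E
      + \sum_(0 <= k < n) (g k x ^+ 2 / a k)%:E)%E); last first.
    apply: leeD; apply: nneseries_lim_ge => k _ _;
      [exact: primal_term_ge0|exact: dual_term_ge0].
  rewrite !sumEFin -EFinD lee_fin -big_split/=.
  apply: le_trans (ler_norm_sum _ _ _) _; apply: ler_sum => k _.
  have ak := a0 k; have ak' : a k != 0 by rewrite gt_eqF.
  have p0 : 0 <= a k * u k x ^+ 2 by rewrite mulr_ge0 ?sqr_ge0 ?ltW.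
  have q0 : 0 <= g k x ^+ 2 / a k by rewrite mulr_ge0 ?sqr_ge0 ?invr_ge0 ?ltW.
  have e : (u k x * g k x) ^+ 2 = (a k * u k x ^+ 2) * (g k x ^+ 2 / a k) by field.
  rewrite -ler_sqr ?nnegrE ?addr_ge0// real_normK ?num_real// e.
  move: p0 q0; set p := _ * _; set q := _ / _; nra.
have [|||iF _ lim] := @dominated_convergence _ _ _ mu `[s, t] mD
  (fun n x => (fn n x)%:E) (EFin \o f) (fun x => primal_density x + dual_density x)%E
  _ mf _ idens _.
- by move=> n; have [/measurable_int] := fnP n.
- apply: aeW => x; rewrite /= in_itv/= => /fP fx.
  by apply: cvg_EFin; [exact: nearW|exact: fx].
- by apply: aeW => x n _; exact: dom.
split=> //.
have L1 : \sum_(0 <= k < n) u k t ^+ 2 - \sum_(0 <= k < n) u k s ^+ 2 @[n --> \oo]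
    --> Et - Es by exact: cvgB.
have L2 : 2 * \int[mu]_(x in `[s, t]) fn n x @[n --> \oo] -->
    2 * \int[mu]_(x in `[s, t]) f x.
  apply: cvgM; first exact: cvg_cst.
  by apply: fine_cvg; rewrite fineK; [exact: lim|exact: integrable_fin_num].
have E12 : (fun n => \sum_(0 <= k < n) u k t ^+ 2 - \sum_(0 <= k < n) u k s ^+ 2) =
    (fun n => 2 * \int[mu]_(x in `[s, t]) fn n x).
  by apply/funext => n; rewrite (fnP n).2.
rewrite E12 in L1.
by rewrite -(cvg_lim (@Rhausdorff R) L1) -(cvg_lim (@Rhausdorff R) L2).
Qed.

End SeriesIdentity.

(** * Decay of weak solutions *)

Section WeakEnergy.
Context (R : realType) (H V : completeNormedModType R).
Context (dot : {dot H for idfun}) (iota : {linear V -> H}).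
Context (A : V -> V -> R^o) (alpha : nat -> R) (e : nat -> V).
Hypothesis H_hilbert : forall h : H, `|h| ^+ 2 = dot h h.
Hypothesis hA1 : assumption_A1 A.
Hypothesis hA2 : assumption_A2 iota.
Hypothesis he : eigenbasis dot iota A alpha e.
Local Notation mu := (@lebesgue_measure R).
Local Notation Rpos := (`]0, +oo[%classic : set R).
Let dotP := dot_psd H_hilbert.

Lemma measurable_finite_range (X : choiceType) (s : R -> X) (phi : X -> R) :
  finite_set (range s) -> (forall x, measurable (s @^-1` [set x])) ->
  measurable_fun setT (fun x => phi (s x)).
Proof.
move=> fin ms _ B mB; rewrite setTI.
rewrite (_ : _ @^-1` _ = \bigcup_(z in range s `&` phi @^-1` B) (s @^-1` [set z])).
  by apply: fin_bigcup_measurable => //; exact: finite_setIl.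
apply/seteqP; split=> [x Bx|x [z [_ Bz] /= ->]//].
by exists (s x) => //; split => //; exists x.
Qed.

(** Testing [f] on the combination of the [e k] with coefficients
    [f (e k) / alpha k], whose energy is the sum itself. *)
Lemma dual_bessel (f : V -> R^o) (d : R) n : linear f -> 0 <= d ->
  (forall v, `|f v| <= d * `|v|) ->
  \sum_(0 <= k < n) f (e k) ^+ 2 / alpha k <= d ^+ 2.
Proof.
move=> lf d0 fd; pose c k := f (e k) / alpha k.
have a0 k : 0 < alpha k := alpha_gt0 he k.
have a0' k : alpha k != 0 by rewrite gt_eqF.
have f0 : f 0 = 0.
  have : f (1 *: 0 + 0) = 1 * f 0 + f 0 := lf 1 0 0.
  by rewrite scale1r addr0 mul1r; lra.
set S := \sum_(0 <= k < n) _.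
have S1 : f (eig_sum e c n) = S.
  rewrite /S /eig_sum; elim/big_rec2: _ => // k z v _ <-.
  have -> : f (c k *: e k + v) = c k * f (e k) + f v := lf _ _ _.
  by rewrite /c mulrAC expr2.
have S2 : `|eig_sum e c n| ^+ 2 = S.
  have := sqr_norm_eig_sumB H_hilbert hA1 he c (leq0n n).
  rewrite {2}/eig_sum {2}/eig_energy !big_geq// !subr0 => ->.
  by apply: eq_bigr => k _; rewrite /c; field.
have S0 : 0 <= S by rewrite -S2 sqr_ge0.
have fS := le_trans (ler_norm _) (fd (eig_sum e c n)); rewrite S1 in fS.
have SS : S ^+ 2 <= d ^+ 2 * S.
  by rewrite -[in leRHS]S2 -exprMn ler_sqr ?nnegrE ?mulr_ge0.
have [->|Sn0] := eqVneq S 0; first by rewrite sqr_ge0.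
by rewrite expr2 ler_pM2r ?lt_def ?Sn0 in SS.
Qed.

Context (y : R -> H) (yV : R -> V) (dy : R -> V -> R^o).
Hypothesis cy : {within `[0, +oo[, continuous y}.
Hypothesis yVy : {ae mu, forall t, 0 < t -> iota (yV t) = y t}.
Hypothesis LyV : forall T : R, 0 < T -> Lp 2 (@enorm R V) `]0, T[ yV.
Hypothesis Ldy : forall T : R, 0 < T -> Lp 2 (@dnorm R V) `]0, T[ dy.
Hypothesis wdy : weak_derivative dot iota y dy.

(** Freezing the state before time 0 makes it continuous on the whole line. *)
Definition extend (x : R) : H := y (Num.max 0 x).

Lemma extendE x : 0 <= x -> extend x = y x.
Proof. by move=> x0; rewrite /extend max_r. Qed.

Lemma continuous_extend : continuous extend.
Proof.
move=> x; have := (subspace_continuousP _ _).1 cy (Num.max 0 x).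
rewrite /= in_itv/= andbT le_max lexx => /(_ isT)/cvgrPdist_le yc.
apply/cvgrPdist_le => eps eps0.
have pre : nbhs x (@ramp R @^-1` _) := @continuous_ramp R x _ (yc eps eps0).
apply: (@filterS _ (nbhs x) _ _ _ _ pre) => z; rewrite /= in_itv/= andbT => yz.
by apply: yz; rewrite /ramp le_max lexx.
Qed.

Lemma continuous_coef k : continuous (fun x => coef dot iota e (extend x) k).
Proof.
move=> x; apply/cvgrPdist_le => /= eps eps0.
have v1 : 0 < `|iota (e k)| + 1 by rewrite ltr_wpDl.
have ev : 0 < eps / (`|iota (e k)| + 1) by rewrite divr_gt0.
have /cvgrPdist_le /(_ _ ev) := @continuous_extend x.
apply: filterS => z zx; rewrite /coef -(formBl dotP).
apply: le_trans (dot_le H_hilbert _ _) _.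
apply: le_trans (ler_wpM2r (normr_ge0 _) zx) _.
by rewrite mulrAC ler_pdivrMr// ler_wpM2l ?ltW// ltrDl.
Qed.

(** The chain rule for the square of the norm, integrated. Along each
    eigenvector the weak derivative integrates to the increments; the two Bessel
    inequalities provide the domination that makes the sum converge. *)
Lemma energy_decrement (s t c : R) : 0 < s -> s <= t ->
  {ae mu, forall x, s <= x <= t -> dy x (yV x) <= - c} ->
  `|y t| ^+ 2 <= `|y s| ^+ 2 - 2 * c * (t - s).
Proof.
move=> s0 st dyc.
pose T := t + 2; have T0 : 0 < T by rewrite /T; lra.
have [[sim [simfin simmeas simbd simcv]] intdy] := Ldy T0.
have [_ intyV] := LyV T0.
have [Z [mZ Z0 subZ]] : {ae mu, forall x, [/\ 0 < x -> iota (yV x) = y x,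
    `]0, T[%classic x -> dnorm (dy x - sim k x) @[k --> \oo] --> 0%E &
    s <= x <= t -> dy x (yV x) <= - c]}.
  apply: (@filterS3 _ _ (ae_filter_ringOfSetsType mu) _ _ _ _ _ yVy simcv dyc) => x; split=> //.
have goodZ x : ~ Z x -> [/\ 0 < x -> iota (yV x) = y x,
   `]0, T[%classic x -> dnorm (dy x - sim k x) @[k --> \oo] --> 0%E &
   s <= x <= t -> dy x (yV x) <= - c].
  by move=> nZ; apply: contrapT => nP; apply: nZ; exact: subZ.
pose I : set R := (`]0, T[%classic : set R); pose G := I `\` Z.
have mI : measurable I by exact: measurable_itv.
have mG : measurable G by exact: measurableD.
have Gpos x : G x -> 0 < x.
  by move=> [+ _]; rewrite /I /= in_itv/= => /andP[].
have GyV x : G x -> iota (yV x) = y x.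
  by move=> Gx; have [_ /goodZ[yx _ _]] := Gx; apply: yx; exact: Gpos.
have Gcv x : G x -> dnorm (dy x - sim k x) @[k --> \oo] --> 0%E.
  by move=> [Ix /goodZ[_ + _]]; apply.
have Gfin x : G x -> (dnorm (dy x) < +oo)%E.
  move=> Gx; have /fine_cvgP[fin _] := Gcv x Gx.
  have [N _ /(_ N (leqnn N)) fN] := fin.
  apply: dnorm_fin_perturb (simbd N x).
  by rewrite -ge0_fin_numE ?dnorm_ge0.
pose u k x := coef dot iota e (extend x) k.
(* cutting [dy] off on the null set [Z] makes the coefficients everywhere
   limits of simple functions, hence Borel *)
pose g k : R -> R := (fun x => dy x (e k)) \_ G.
have a0 k : 0 < alpha k := alpha_gt0 he k.
have cu k : continuous (u k) := @continuous_coef k.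
have mg k : measurable_fun setT (g k).
  apply: (@measurable_fun_cvg _ _ _ _ (fun j => (fun x => sim j x (e k)) \_ G)).
    move=> j; apply/(measurable_restrictT _ mG); apply: measurable_funTS.
    exact: (@measurable_finite_range _ (sim j) (fun f => f (e k))).
  move=> x _; rewrite /g patchE; case: ifPn => [/set_mem Gx|nGx].
    rewrite (_ : (fun j => _) = (fun j => sim j x (e k))).
      exact: dnorm_cvg_eval (Gcv x Gx).
    by apply/funext => j; rewrite patchE mem_set.
  rewrite (_ : (fun j => _) = cst 0); first exact: cvg_cst.
  by apply/funext => j; rewrite patchE (negbTE nGx).
have Gprimal x : G x -> (primal_density alpha u x <= enorm (yV x) ^+ 2)%E.
  move=> Gx; apply: lime_le.
    by apply: is_cvg_nneseries => k _ _; exact: primal_term_ge0.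
  apply: nearW => n; rewrite sumEFin /enorm -EFin_expe lee_fin.
  apply: le_trans (bessel_energy H_hilbert hA1 he (yV x) n).
  by rewrite /eig_energy GyV// /u extendE// ltW// Gpos.
have Gdual x : G x -> (dual_density alpha g x <= dnorm (dy x) ^+ 2)%E.
  move=> Gx; have fx : dnorm (dy x) \is a fin_num by rewrite ge0_fin_numE ?dnorm_ge0 ?Gfin.
  rewrite -(fineK fx) -EFin_expe; apply: lime_le.
    by apply: is_cvg_nneseries => k _ _; exact: dual_term_ge0.
  apply: nearW => n; rewrite sumEFin lee_fin.
  rewrite (_ : \sum_(0 <= k < n) _ = \sum_(0 <= k < n) dy x (e k) ^+ 2 / alpha k).
    apply: dual_bessel; [exact: dnorm_linear (Gfin _ Gx)|by rewrite fine_ge0 ?dnorm_ge0|].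
    by move=> v; apply: dnorm_le; rewrite fineK.
  by apply: eq_bigr => k _; rewrite /g patchE mem_set.
have finP : (\int[mu]_(x in I) primal_density alpha u x < +oo)%E.
  apply: le_lt_trans intyV; apply: (null_le_integral mZ Z0).
  - by move=> x _; exact: primal_density_ge0.
  - by move=> x _; rewrite /enorm -EFin_expe lee_fin sqr_ge0.
  - by move=> x Ix nZx; exact: Gprimal.
have finD : (\int[mu]_(x in I) dual_density alpha g x < +oo)%E.
  apply: le_lt_trans intdy; apply: (null_le_integral mZ Z0).
  - by move=> x _; exact: dual_density_ge0.
  - by move=> x _; rewrite expe2 mule_ge0 ?dnorm_ge0.
  - by move=> x Ix nZx; exact: Gdual.
have sub b d : 0 < b -> d <= t + 1 -> `[b, d]%classic `<=` I.
  by move=> b0 dt x; rewrite /I /= !in_itv/= => /andP[? ?]; apply/andP; split; rewrite /T; lra.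
have finPs b d : 0 < b -> d <= t + 1 ->
    (\int[mu]_(x in `[b, d]) primal_density alpha u x < +oo)%E.
  move=> b0 dt; apply: le_lt_trans finP; apply: ge0_subset_integral => //.
  - exact: measurable_primal_density.
  - by move=> x _; exact: primal_density_ge0.
  - exact: sub.
have finDs b d : 0 < b -> d <= t + 1 ->
    (\int[mu]_(x in `[b, d]) dual_density alpha g x < +oo)%E.
  move=> b0 dt; apply: le_lt_trans finD; apply: ge0_subset_integral => //.
  - exact: measurable_dual_density.
  - by move=> x _; exact: dual_density_ge0.
  - exact: sub.
pose f : R -> R := (fun x => dy x (yV x)) \_ G.
have incr k b d : s <= b -> b <= d -> d <= t ->
    u k d - u k b = \int[mu]_(x in `[b, d]) g k x.
  move=> sb bd dt; apply: weak_derivative_integral => //.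
  - by lra.
  - by apply: (integrable_dual_coef a0 mg); apply: finDs; lra.
  move=> phi tphi phi0; have := wdy (e k) tphi.
  rewrite (_ : \int[mu]_(x in Rpos) (derive1 phi x * toV' dot iota (y x) (e k)) =
     \int[mu]_(x in Rpos) (derive1 phi x * u k x)); last first.
    apply: eq_Rintegral => x; rewrite inE /= in_itv/= andbT => x0.
    by rewrite /u extendE ?ltW.
  move=> ->; congr (- fine _); apply: (null_eq_integral mZ Z0) => x _ nZx.
  rewrite /g patchE; case: ifPn => // nGx; rewrite phi0 ?mul0r//.
  move=> /andP[bx xd]; move/negP: nGx; apply; rewrite inE; split=> //.
  by rewrite /I /= in_itv/= /T; apply/andP; split; lra.
have lim x : s <= x <= t -> \sum_(0 <= k < n) u k x * g k x @[n --> \oo] --> f x.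
  move=> /andP[sx xt]; rewrite /f patchE; case: ifPn => [/set_mem Gx|nGx]; last first.
    rewrite (_ : (fun n => _) = cst 0); first exact: cvg_cst.
    by apply/funext => n; rewrite big1// => k _; rewrite /g patchE (negbTE nGx) mulr0.
  have lf := dnorm_linear (Gfin x Gx).
  rewrite (_ : (fun n => _) = (fun n => dy x (eig_sum e (coef dot iota e (iota (yV x))) n))); last first.
    apply/funext => n; rewrite /eig_sum.
    have f0 : dy x 0 = 0.
      have : dy x (1 *: 0 + 0) = 1 * dy x 0 + dy x 0 := lf 1 0 0.
      by rewrite scale1r addr0 mul1r; lra.
    elim/big_rec2: _ => // k v z _ ->.
    have -> : forall c, dy x (c *: e k + v) = c * dy x (e k) + dy x v.
      by move=> c'; exact: lf.
    by rewrite /g patchE mem_set// GyV// /u extendE// ltW// Gpos.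
  have [C [C0 _ _ dyC]] := opnorm_bound (Gfin x Gx).
  apply/cvgrPdist_le => /= eps eps0.
  have C1 : 0 < C + 1 by lra.
  have eC : 0 < eps / (C + 1) by rewrite divr_gt0.
  have /cvgrPdist_le /(_ _ eC) := eig_sum_coef_cvg H_hilbert hA1 hA2 he (v := yV x).
  apply: filterS => n vn.
  have -> : dy x (yV x) - dy x (eig_sum e (coef dot iota e (iota (yV x))) n) =
      dy x (yV x - eig_sum e (coef dot iota e (iota (yV x))) n).
    set w := eig_sum _ _ _; have : dy x (-1 *: w + yV x) = -1 * dy x w + dy x (yV x) := lf _ _ _.
    by rewrite scaleN1r [_ + yV x]addrC => ->; ring.
  have := dyC (yV x - eig_sum e (coef dot iota e (iota (yV x))) n).
  rewrite /enorm lee_fin => /le_trans; apply.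
  apply: le_trans (ler_wpM2l C0 vn) _.
  by rewrite mulrA ler_pdivrMr// mulrC ler_wpM2l ?ltW// ltrDl.
have par x : 0 < x -> \sum_(0 <= k < n) u k x ^+ 2 @[n --> \oo] --> `|y x| ^+ 2.
  by move=> x0; rewrite -(extendE (ltW x0)); exact: (parseval H_hilbert he).
have [|||iF E] := @sum_sqr_increment _ alpha u g a0 cu mg f s t _ _ st _ _ incr lim (par s s0) (par t _).
- by apply: finPs; lra.
- by apply: finDs; lra.
- by lra.
have fc : \int[mu]_(x in `[s, t]) f x <= - c * (t - s).
  have -> : \int[mu]_(x in `[s, t]) f x = \int[mu]_(x in `[s, t] `\` Z) f x.
    by congr fine; exact: negligible_integral.
  have mS : measurable (`[s, t]%classic : set R) by exact: measurable_itv.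
  have icst : mu.-integrable `[s, t] (EFin \o cst (- c)).
    by apply: continuous_integrable; exact: continuous_constf.
  apply: (@le_trans _ _ (\int[mu]_(x in `[s, t] `\` Z) cst (- c) x)).
    apply: le_Rintegral; first exact: measurableD.
    - by apply: integrableS iF => //; exact: measurableD.
    - by apply: integrableS icst => //; exact: measurableD.
    move=> x [/= xst nZx]; rewrite in_itv/= in xst.
    have Gx : G x.
      split=> //; rewrite /I /= in_itv/= /T.
      by move/andP: xst => [? ?]; apply/andP; split; lra.
    by rewrite /f patchE mem_set//; have [_ _] := goodZ x nZx; apply.
  have <- : \int[mu]_(x in `[s, t]) cst (- c) x = \int[mu]_(x in `[s, t] `\` Z) cst (- c) x.
    by congr fine; exact: negligible_integral.
  have len : mu `[s, t]%classic = (t - s)%:E.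
    have E' := @lebesgue_measure_itv R `[s, t]; rewrite /= lte_fin in E'.
    apply: (etrans E'); case: ifPn => [_|]; first by rewrite -EFinB.
    by rewrite -leNgt => ts; rewrite (_ : t = s) ?subrr//; lra.
  by rewrite Rintegral_cst// -[t - s]/(fine (t - s)%:E) -len.
have -> : `|y t| ^+ 2 = `|y s| ^+ 2 + 2 * \int[mu]_(x in `[s, t]) f x by rewrite -E; ring.
by rewrite lerD2l -mulrA -mulrN ler_pM2l// -mulNr.
Qed.

(** The square of the norm first decreases, hence dominates its final value in the
    energy inequality; this gives the bound [1 / (1 + 2 (m + 1) d)] for a time
    step [d], and the margin between [m] and [m + 1] turns it into an
    exponential when [d] is small. *)
Lemma local_decay (m a b : R) : 0 < m -> 0 < a -> a <= b ->
  2 * m * (m + 1) * (b - a) <= 1 ->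
  {ae mu, forall x, a <= x <= b -> dy x (yV x) <= - ((m + 1) * `|y x| ^+ 2)} ->
  `|y b| ^+ 2 <= expR (- (2 * m * (b - a))) * `|y a| ^+ 2.
Proof.
move=> m0 a0 ab short diss.
have mono c d : a <= c -> c <= d -> d <= b -> `|y d| ^+ 2 <= `|y c| ^+ 2.
  move=> ac cd db; have c0 : 0 < c by lra.
  have dec := @energy_decrement c d 0 c0 cd.
  rewrite mulr0 mul0r subr0 in dec; apply: dec.
  apply: (@filterS _ _ (ae_filter_ringOfSetsType mu) _ _ _ diss) => x dx /andP[cx xd].
  apply: le_trans (dx _) _; first by apply/andP; split; lra.
  by rewrite oppr0 oppr_le0 mulr_ge0 ?sqr_ge0//; lra.
have : `|y b| ^+ 2 <= `|y a| ^+ 2 - 2 * ((m + 1) * `|y b| ^+ 2) * (b - a).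
  apply: energy_decrement => //.
  apply: (@filterS _ _ (ae_filter_ringOfSetsType mu) _ _ _ diss) => x dx axb.
  apply: le_trans (dx axb) _; rewrite lerN2 ler_wpM2l//; first by lra.
  by move/andP: axb => [ax xb]; exact: mono.
have := expR_ge1Dx (- (2 * m * (b - a))).
have := sqr_ge0 `|y b|; have := sqr_ge0 `|y a|.
move: (`|y a| ^+ 2) (`|y b| ^+ 2) (expR _) => Ea Eb ex Ea0 Eb0 ex1 dec.
have : 0 <= b - a by lra.
move: (b - a) short ex1 dec => d short ex1 dec d0.
have step1' : (1 - 2 * m * d) * Ea <= ex * Ea by apply: ler_wpM2r => //; lra.
apply: le_trans step1'.
have q0 : 0 <= 1 - 2 * m * d by nra.
have : (1 - 2 * m * d) * (Eb + 2 * ((m + 1) * Eb) * d) <= (1 - 2 * m * d) * Ea.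
  by apply: ler_wpM2l => //; lra.
apply: le_trans.
have -> : (1 - 2 * m * d) * (Eb + 2 * ((m + 1) * Eb) * d) =
  Eb + 2 * d * Eb * (1 - 2 * m * (m + 1) * d) by ring.
by rewrite lerDl !mulr_ge0//; lra.
Qed.

Lemma continuous_norm_extend : continuous (fun x => `|extend x|).
Proof. by move=> x; apply: cvg_norm; exact: continuous_extend. Qed.

(** Dissipation is only available on the ball of radius [r + 1]; a state of norm
    less than [r] cannot leave it, since decay holds as long as it has not. *)
Lemma dissipation_exp_decay (r m : R) : 0 < r -> 0 < m -> `|y 0| < r ->
  {ae mu, forall x, 0 < x -> `|y x| <= r + 1 ->
     dy x (yV x) <= - ((m + 1) * `|y x| ^+ 2)} ->
  exp_decay m y.
Proof.
move=> r0 m0 y0r diss.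
pose E x := `|extend x| ^+ 2.
pose P a b : Prop := `|extend a| < r -> E b <= expR (- (2 * m * (b - a))) * E a.
have E_le a b : a <= b -> E b <= expR (- (2 * m * (b - a))) * E a -> E b <= E a.
  move=> ab /le_trans; apply; apply: ler_piMl; first exact: sqr_ge0.
  by rewrite -expR0 ler_expR oppr_le0 !mulr_ge0 ?subr_ge0// ltW.
have E_lt a b : E b <= E a -> `|extend a| < r -> `|extend b| < r.
  by rewrite /E ler_sqr ?nnegrE//; exact: le_lt_trans.
have decay s t : 0 < s -> s <= t -> P s t.
  move=> s0 st; apply: (@interval_chain _ P) => //.
    move=> a b c sa ab bc ct Pab Pbc ar.
    have Eb := Pab ar; have br := E_lt _ _ (E_le _ _ ab Eb) ar.
    apply: le_trans (Pbc br) _; apply: le_trans (ler_wpM2l (expR_ge0 _) Eb) _.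
    rewrite mulrA -expRD ler_wpM2r ?sqr_ge0// ler_expR; lra.
  move=> x /andP[sx xt].
  have cont (eps : R) : 0 < eps -> exists2 d : R, 0 < d &
      forall z, `|x - z| < d -> `| `|extend x| - `|extend z| | < eps.
    move=> eps0; have /cvgrPdist_lt /(_ _ eps0) := @continuous_norm_extend x.
    by move=> [d /= d0 dP]; exists d => // z xz; exact: dP.
  (* near such a point no state has norm below [r] *)
  have [xr|xr] := ltP `|extend x| (r + 1); last first.
    have [d d0 dP] := cont 1 ltr01; exists d => // a b sa ax xb bt bad ar.
    have xa : `|x - a| < d by rewrite ltr_norml; apply/andP; split; lra.
    have := dP a xa; rewrite ltr_norml => /andP[? ?]; exfalso; lra.
  have gap0 : 0 < r + 1 - `|extend x| by lra.
  have [d d0 dP] := cont _ gap0.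
  pose d1 := (2 * m * (m + 1))^-1.
  have d10 : 0 < d1 by rewrite invr_gt0 !mulr_gt0//; lra.
  exists (Num.min d d1); first by rewrite lt_min d0 d10.
  move=> a b sa ax xb bt; rewrite lt_min => /andP[bad bad1] ar.
  have a0 : 0 < a by lra.
  have b0 : 0 < b by lra.
  rewrite /E !extendE ?(ltW a0) ?(ltW b0)//.
  apply: local_decay => //; [by lra| |].
    rewrite mulrC -ler_pdivlMr ?div1r ?(ltW bad1)//.
    by rewrite !mulr_gt0//; lra.
  apply: (@filterS _ _ (ae_filter_ringOfSetsType mu) _ _ _ diss) => z zP /andP[az zb].
  apply: zP; first by lra.
  have z0 : 0 <= z by lra.
  rewrite -(extendE z0).
  have xz : `|x - z| < d by rewrite ltr_norml; apply/andP; split; lra.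
  have := dP z xz; rewrite ltr_norml => /andP[? ?]; lra.
have ext0 : extend 0 = y 0 by rewrite extendE.
have decay0 t : 0 < t -> P 0 t.
  move=> t0 y0r'.
  pose F s := expR (- (2 * m * (t - s))) * E s.
  have cF : F s @[s --> 0^'+] --> F 0.
    apply: cvg_at_right_filter; apply: cvgM; last first.
      by apply: cvgM; exact: continuous_norm_extend.
    apply: continuous_comp; last exact: continuous_expR.
    apply: cvgN; apply: cvgM; first exact: cvg_cst.
    by apply: cvgB => //; exact: cvg_cst.
  apply: (cvgr_to_ge cF).
  have gap0 : 0 < r - `|extend 0| by lra.
  have /cvgrPdist_lt /(_ _ gap0) [d /= d0 dP] := @continuous_norm_extend 0.
  near=> s.
  have s0 : 0 < s by near: s; exact: nbhs_right_gt.
  have st : s < t by near: s; exact: nbhs_right_lt.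
  have sd : s < d by near: s; exact: nbhs_right_lt.
  apply: decay => //; first exact: ltW.
  have := dP s; rewrite /= sub0r normrN gtr0_norm// => /(_ sd).
  by rewrite ltr_norml => /andP[? ?]; lra.
have all_r s : 0 <= s -> `|extend s| < r.
  rewrite le_eqVlt => /orP[/eqP <-|s0]; first by rewrite ext0.
  have y0r' : `|extend 0| < r by rewrite ext0.
  exact: (E_lt _ _ (E_le _ _ (ltW s0) (decay0 s s0 y0r')) y0r').
have decay_all s t : 0 <= s -> s <= t -> E t <= expR (- (2 * m * (t - s))) * E s.
  rewrite le_eqVlt => /orP[/eqP <-|s0] st; last by apply: decay => //; apply: all_r; exact: ltW.
  move: st; rewrite le_eqVlt => /orP[/eqP <-|t0]; last by apply: decay0 => //; exact: all_r.
  by rewrite subrr mulr0 oppr0 expR0 mul1r.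
move=> s t s0 st; have t0 : 0 <= t by lra.
have := decay_all s t s0 st; rewrite /E !extendE//.
rewrite (_ : - (2 * m * (t - s)) = - m * (t - s) + - m * (t - s)); last by ring.
rewrite expRD -expr2 -exprMn ler_sqr ?nnegrE ?mulr_ge0 ?expR_ge0//.
Unshelve. all: by end_near. Qed.

End WeakEnergy.

Lemma exp_decay_strict (R : realType) (H : completeNormedModType R) (m : R)
    (y : R -> H) (s : R) : 0 < m -> exp_decay m y -> 0 <= s -> `|y s| != 0 ->
  strictly_decreasing_at y s.
Proof.
move=> m0 dec s0 ys t st; apply: le_lt_trans (dec _ _ s0 (ltW st)) _.
have ys0 : 0 < `|y s| by rewrite lt_def ys normr_ge0.
by rewrite gtr_pMl// expR_lt1 mulNr oppr_lt0 mulr_gt0// subr_gt0.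
Qed.

(** * Choice of the number of actuators and of the gain *)

Section Stabilization.
Context (R : realType) (H V : completeNormedModType R).
Context (dot : {dot H for idfun}) (iota : {linear V -> H}).
Context (A : V -> V -> R^o) (alpha : nat -> R) (e : nat -> V).
Hypothesis H_hilbert : forall h : H, `|h| ^+ 2 = dot h h.
Hypothesis hA1 : assumption_A1 A.
Hypothesis hA2 : assumption_A2 iota.
Hypothesis he : eigenbasis dot iota A alpha e.
Context (n : nat) (zeta1 zeta2 delta1 delta2 : 'I_n -> R).
Hypothesis hA4 : A4_exponents zeta1 zeta2 delta1 delta2.
Local Notation mu := (@lebesgue_measure R).
Local Notation weight := (nonlin_weight zeta1 zeta2 delta1 delta2).

Lemma nonlin_weight_exponents j :
  0 <= (1 + (zeta2 j + delta2 j)) / (1 - (zeta2 j + delta2 j)) /\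
  0 <= 2 * (zeta1 j + delta1 j) / (1 - (zeta2 j + delta2 j)) - 2.
Proof.
have [_ /(_ j) [[z1 z2 d1 d2] zd dd]] := hA4.
have zd0 : 0 < 1 - (zeta2 j + delta2 j) by lra.
split; first by rewrite divr_ge0//; lra.
by rewrite subr_ge0 ler_pdivlMr//; lra.
Qed.

Lemma nonlin_weight_ge0 r CN : 0 <= CN -> 0 <= weight r CN.
Proof.
move=> CN0; rewrite mulr_ge0 ?mulr_ge0//; apply: sumr_ge0 => j _.
by rewrite mulr_ge0 ?powR_ge0.
Qed.

Lemma nonlin_weight_mono r r' CN CN' : 0 <= r -> r <= r' -> 0 <= CN -> CN <= CN' ->
  weight r CN <= weight r' CN'.
Proof.
move=> r0 rr C0 CC; have n0 : (0 : R) <= n%:R by [].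
apply: ler_pM; [exact: mulr_ge0| |lra|].
  by apply: sumr_ge0 => j _; rewrite mulr_ge0 ?powR_ge0.
apply: ler_sum => j _; have [p0 q0] := nonlin_weight_exponents j.
have mono x y p : 0 <= p -> 0 <= (x : R) -> x <= y -> x `^ p <= y `^ p.
  by move=> p0' x0 xy; apply: ge0_ler_powR; rewrite ?nnegrE//; exact: le_trans xy.
apply: ler_pM; rewrite ?powR_ge0//; last exact: mono.
apply: mono => //; first by rewrite !mulr_ge0//; lra.
by rewrite ler_wpM2l ?mulr_ge0//; lra.
Qed.

(** The rate [m + 1] and the radius [r + 1] are the margins that local decay and
    the confinement to a ball require. *)
Definition damping_need (r m Crc CN : R) : R :=
  (m + 1) + 4 * (Crc + 2) ^+ 2 + weight (r + 1) CN.

Lemma damping_need_ge0 r m Crc CN : 0 <= m -> 0 <= CN ->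
  0 <= damping_need r m Crc CN.
Proof.
move=> m0 C0; rewrite /damping_need.
by have := sqr_ge0 (Crc + 2); have := nonlin_weight_ge0 (r + 1) C0; lra.
Qed.

Lemma damping_need_mono r r' m m' Crc Crc' CN CN' :
  0 <= r <= r' -> 0 <= m <= m' -> 0 <= Crc <= Crc' -> 0 <= CN <= CN' ->
  damping_need r m Crc CN <= damping_need r' m' Crc' CN'.
Proof.
move=> /andP[r0 rr] /andP[m0 mm] /andP[c0 cc] /andP[C0 CC].
apply: lerD; last by apply: nonlin_weight_mono => //; lra.
by apply: lerD; [lra|]; rewrite ler_wpM2l// ler_sqr ?nnegrE; lra.
Qed.

Lemma xi_plus_gap (U : set H) (xi : R) : (xi%:E <= xi_plus dot iota U)%E ->
  forall w, perp dot U (iota w) -> xi * `|iota w| ^+ 2 <= `|w| ^+ 2.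
Proof.
move=> xiU w Uw; have [->|w0] := eqVneq w 0.
  by rewrite linear0 !normr0 expr0n mulr0.
have [inj _ _ _] := hA2.
have iw : 0 < `|iota w| ^+ 2.
  rewrite exprn_gt0// normr_gt0; apply: contra w0 => /eqP iw0.
  by apply/eqP/inj; rewrite iw0 linear0.
rewrite -ler_pdivlMr// -lee_fin; apply: le_trans xiU _.
by apply: ereal_inf_lbound; exists w.
Qed.

Lemma coercive_feedback_stabilizes (U : set H) (xi kappa lambda r m Crc CN : R)
    (F : H -> V -> R^o) (Arc N : R -> V -> V -> R^o) :
  0 < r -> 0 < m ->
  assumption_A3 dot iota Arc Crc ->
  assumption_A4 iota zeta1 zeta2 delta1 delta2 N CN ->
  0 < xi -> 8 * damping_need r m Crc CN <= xi -> (xi%:E <= xi_plus dot iota U)%E ->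
  0 < kappa ->
  (forall v, exists q : V, perp dot U (iota (v - q)) /\
     kappa * `|q| ^+ 2 <= F (iota v) v) ->
  (1 + 2 * damping_need r m Crc CN / alpha 0) / kappa <= lambda ->
  stabilizes dot iota A Arc N lambda F r m.
Proof.
move=> r0 m0 [_ _ ArcC] A4N xi0 Dxi xiU k0 Fq lam y0 y y0r
  [cy y0E [yV [dy [yVy LyV Ldy wdy eqn]]]].
have [aeN CN0 _ _] := A4N.
have D0 : 0 <= damping_need r m Crc CN by apply: damping_need_ge0 => //; exact: ltW.
have [_ _ Anorm] := hA1.
suff dec : exp_decay m y by split=> // s s0 ys; exact: (exp_decay_strict m0).
apply: (dissipation_exp_decay H_hilbert hA1 hA2 he cy yVy LyV Ldy wdy r0 m0).
  by rewrite y0E.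
have aeArc : {ae mu, forall t, 0 < t -> (sum_norm dot iota (Arc t) <= Crc%:E)%E}.
  have := ess_sup_ge mu ((fun t => sum_norm dot iota (Arc t)) \_ (`]0, +oo[%classic : set R)).
  rewrite -/(Linfty_norm _ _ _) ArcC.
  apply: (@filterS _ _ (ae_filter_ringOfSetsType mu)) => t + t0.
  by rewrite patchE mem_set//= in_itv/= t0.
have ae1 := @filterI _ _ (ae_filter_ringOfSetsType mu) _ _ yVy eqn.
have ae2 := @filterI _ _ (ae_filter_ringOfSetsType mu) _ _ aeArc aeN.
apply: (@filterS2 _ _ (ae_filter_ringOfSetsType mu) _ _ _ _ ae1 ae2).
move=> t [yVt eqt] [Arct Nt] t0 yr; have yE := yVt t0.
set v := yV t in yE eqt *; rewrite -yE in yr *.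
have [q [Uq qF]] := Fq v.
have Aest := reaction_bound H_hilbert v (Arct t0).
have Nest := nonlin_bound hA2 hA4 A4N t0 (Nt t0) yr.
have Gest := gap_estimate H_hilbert hA1 he xi0 D0 Dxi k0 (xi_plus_gap xiU) Uq qF lam.
have E : dy t v + A v v + Arc t v v + N t v v = - (lambda * F (iota v) v).
  by rewrite [in RHS]yE; exact: (congr1 (fun f : V -> R^o => f v) (eqt t0)).
rewrite Anorm in E.
move: Aest Nest Gest E; rewrite !ler_norml /damping_need.
move=> /andP[Aest _] /andP[Nest _].
move: (`|v| ^+ 2) (`|iota v| ^+ 2) Aest Nest => a b Aest Nest Gest E.
lra.
Qed.

End Stabilization.

Theorem corollary3p11
  (R : realType) (H V : completeNormedModType R)
  (dot : {dot H for idfun}) (iota : {linear V -> H})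
  (A : V -> V -> R^o) (alpha : nat -> R) (e : nat -> V) (rho : R)
  (sigma : nat -> nat) (Phi : forall M : nat, 'I_(sigma M) -> H)
  (Ut : nat -> set V)
  (n : nat) (zeta1 zeta2 delta1 delta2 : 'I_n -> R)
  (H_hilbert : forall h : H, `|h| ^+ 2 = dot h h)
  (hA1 : assumption_A1 A)
  (hA2 : assumption_A2 iota)
  (hA4 : A4_exponents zeta1 zeta2 delta1 delta2)
  (hA5 : assumption_A5 dot iota Phi)
  (hUt : forall M, (0 < M)%N -> has_dim (Ut M) (sigma M))
  (hsum : forall M, (0 < M)%N ->
     direct_sum (lspan (Phi M)) (perp dot (iota @` Ut M)))
  (he : eigenbasis dot iota A alpha e)
  (hrho : rho <= 1) :
  exists (Mbar : R -> R -> R -> R -> nat) (lbar : R -> R -> R -> R -> R),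
    [/\ nondecreasing4 Mbar, nondecreasing4 lbar,
        forall a1 a2 a3 a4 : R, 0 <= lbar a1 a2 a3 a4 &
    forall (r mu Crc CN : R) (Arc N : R -> V -> V -> R^o),
      0 < r -> 0 < mu ->
      assumption_A3 dot iota Arc Crc ->
      assumption_A4 iota zeta1 zeta2 delta1 delta2 N CN ->
      exists (Mstar : nat) (lstar : nat -> R),
        [/\ (0 < Mstar)%N,
            (Mstar <= Mbar r mu Crc CN)%N,
            lstar (Mbar r mu Crc CN) <= lbar r mu Crc CN &
        forall M, (Mstar <= M)%N ->
          0 < lstar M /\
          forall lambda : R, lstar M <= lambda ->
            stabilizes dot iota A Arc N lambda
              (feedback_orth dot iota (lspan (Phi M))) r mu /\
            stabilizes dot iota A Arc N lambda
              (feedback_oblique dot iota alpha e rho (lspan (Phi M)) (Ut M))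
              r mu]].
Proof.
have a00 := alpha_gt0 he 0.
have [_ _ _ xi_cvg] := hA5.
have kappa_ex M : exists k : R, 0 < k /\
    ((0 < M)%N -> forall v, exists q : V, [/\ perp dot (lspan (Phi M)) (iota (v - q)),
    k * `|q| ^+ 2 <= feedback_orth dot iota (lspan (Phi M)) (iota v) v &
    k * `|q| ^+ 2 <= feedback_oblique dot iota alpha e rho (lspan (Phi M)) (Ut M) (iota v) v]).
  have [->|M0] := posnP M; first by exists 1.
  have [_ _ /(_ _ M0) dimU _] := hA5.
  have [k k0 kP] := feedback_coercive H_hilbert hA1 hA2 he hrho dimU (hUt M M0) (hsum M M0).
  by exists k.
have [kappa kappaP] := choice kappa_ex.
(* the least index with the required gap is monotone in the requirement *)
pose gap (x : R) (M : nat) : bool := (0 < M)%N &&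
  `[< forall M', (M <= M')%N -> (x%:E <= xi_plus dot iota (lspan (Phi M')))%E >].
have gap_ex x : exists M, gap x M.
  have /cvgeyPge /(_ x) [N _ NP] := xi_cvg.
  exists N.+1; rewrite /gap /=; apply/asboolP => M' NM'; apply: NP => /=.
  exact: ltnW.
pose need := damping_need zeta1 zeta2 delta1 delta2.
pose Mbar r mu Crc CN : nat := ex_minn (gap_ex (8 * need r mu Crc CN + 1)).
pose gain (D : R) (M : nat) := (1 + 2 * `|D| / alpha 0) / kappa M.
have gain_gt0 D M : 0 < gain D M.
  have [k0 _] := kappaP M; rewrite divr_gt0// ltr_wpDr//.
  by rewrite !mulr_ge0// invr_ge0 ltW.
(* a sum instead of the single gain at [Mbar], which need not be monotone in [M] *)
pose lbar r mu Crc CN : R := \sum_(0 <= M < (Mbar r mu Crc CN).+1) gain (need r mu Crc CN) M.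
have need_mono a1 a2 a3 a4 b1 b2 b3 b4 : 0 <= a1 <= b1 -> 0 <= a2 <= b2 ->
    0 <= a3 <= b3 -> 0 <= a4 <= b4 -> need a1 a2 a3 a4 <= need b1 b2 b3 b4.
  exact: (damping_need_mono hA4).
have Mbar_mono : nondecreasing4 Mbar.
  move=> a1 a2 a3 a4 b1 b2 b3 b4 h1 h2 h3 h4; rewrite /Mbar.
  case: ex_minnP => Ma _ minMa; case: ex_minnP => Mb /andP[Mb0 /asboolP gapb] _.
  apply: minMa; rewrite /gap Mb0; apply/asboolP => M' /gapb; apply: le_trans.
  by rewrite lee_fin lerD2r ler_pM2l//; exact: need_mono.
exists Mbar, lbar; split=> //.
- move=> a1 a2 a3 a4 b1 b2 b3 b4 h1 h2 h3 h4.
  have Mab : (Mbar a1 a2 a3 a4 <= Mbar b1 b2 b3 b4)%N by exact: Mbar_mono.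
  rewrite /lbar [leRHS](@big_cat_nat _ _ _ (Mbar a1 a2 a3 a4).+1)//=.
  apply: ler_wpDr; first by apply: sumr_ge0 => M _; exact: ltW.
  apply: ler_sum => M _; have [k0 _] := kappaP M.
  rewrite ler_wpM2r ?invr_ge0 ?(ltW k0)// lerD2l ler_wpM2r ?invr_ge0 ?(ltW a00)//.
  have n0 : 0 <= need a1 a2 a3 a4.
    by apply: damping_need_ge0; [case/andP: h2|case/andP: h4].
  have nm := need_mono _ _ _ _ _ _ _ _ h1 h2 h3 h4.
  by rewrite ler_pM2l// !ger0_norm//; exact: le_trans nm.
- by move=> *; apply: sumr_ge0 => M _; exact: ltW.
move=> r m Crc CN Arc N r0 m0 A3 A4.
have CN0 : 0 <= CN by have [] := A4.
pose D := need r m Crc CN.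
have D0 : 0 <= D by apply: damping_need_ge0 => //; exact: ltW.
exists (Mbar r m Crc CN), (gain D); split=> //.
- by rewrite /Mbar; case: ex_minnP => M /andP[].
- by rewrite /lbar big_nat_recr//= lerDr; apply: sumr_ge0 => M _; exact: ltW.
move=> M MM; split=> // lambda lam.
have [M0 gapM] : (0 < M)%N /\ ((8 * D + 1)%:E <= xi_plus dot iota (lspan (Phi M)))%E.
  move: MM; rewrite /Mbar; case: ex_minnP => M1 /andP[M10 /asboolP gapM1] _ MM.
  by split; [exact: leq_trans MM|exact: gapM1].
have [k0 kP] := kappaP M.
rewrite /gain ger0_norm// in lam.
have xi0 : 0 < 8 * D + 1 by rewrite ltr_wpDl// mulr_ge0.
have Dxi : 8 * D <= 8 * D + 1 by rewrite lerDl.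
split; apply: (coercive_feedback_stabilizes H_hilbert hA1 hA2 he hA4 r0 m0 A3 A4
  xi0 Dxi gapM k0 _ lam) => v; have [q [Uq orthq obliq]] := kP M0 v; by exists q.
Qed.
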